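(* Let $\Omega \subset \mathbb{R}^d$ be a bounded domain and let $k(x,z) = \Phi(x-z)$ be a translational invariant kernel whose Fourier transform satisfies, for some $\tau>d/2$ and constants $c_\Phi,C_\Phi>0$, $$c_\Phi (1+\|\omega\|^2)^{-\tau} \le \hat\Phi(\omega) \le C_\Phi (1+\|\omega\|^2)^{-\tau} \qquad\text{for all }\omega\in\mathbb{R}^d .$$ Then there exists a constant $c>0$, depending only on the dimension $d$, the kernel $k$ and the domain $\Omega$, such that for any finite set $X\subset\Omega$ of pairwise distinct points the condition number of $k^*(X,X)$ can be bounded as $$\mathrm{cond}(k^*(X,X)) \;\le\; c \cdot q^{-4\tau},$$ with $q := \min(\mathrm{dist}(X,\partial\Omega), q_X) > 0$.
   Context: $\|\cdot\|$ is the Euclidean norm. A translational invariant kernel is a symmetric kernel of the form $k(x,z)=\Phi(x-z)$ with $\Phi:\mathbb{R}^d\to\mathbb{R}$; the Fourier transform $\hat\Phi:\mathbb{R}^d\to\mathbb{R}$ is normalized so that $\Phi(x-z)=(2\pi)^{-d/2}\int_{\mathbb{R}^d}\hat\Phi(\omega)e^{i\omega^\top(x-z)}\,d\omega$. The convolutional kernel $k^*:\Omega\times\Omega\to\mathbb{R}$ of $k$ is $k^*(x,z) := \int_\Omega k(x,y)\,k(y,z)\,dy$, and for $X=\{x_1,\dots,x_n\}$ its kernel matrix is $k^*(X,X):=(k^*(x_i,x_j))_{1\le i,j\le n}$. For a symmetric positive definite matrix $A$, $\mathrm{cond}(A):=\lambda_{\max}(A)/\lambda_{\min}(A)$. The separation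 distance (for $n\ge2$) is $q_X:=\frac12\min_{x_i\ne x_j\in X}\|x_i-x_j\|$, and $\mathrm{dist}(X,\partial\Omega)$ is the distance of $X$ to the boundary of $\Omega$. *)

(* Defs.v *)
From HB Require Import structures.
From mathcomp Require Import all_boot all_order all_algebra.
From mathcomp Require Import all_classical all_reals all_analysis.
From mathcomp Require Import complex.

Set Implicit Arguments.
Unset Strict Implicit.
Unset Printing Implicit Defensive.

Import Order.TTheory GRing.Theory Num.Theory.
Import numFieldNormedType.Exports.

Local Open Scope classical_set_scope.
Local Open Scope ring_scope.

(* The product sigma-algebra on row vectors, set up as the library does for   *)
(* tuples; for T := R : realType it is the Borel sigma-algebra of R^n.        *)
Section measurable_rV.
Context {d} {T : measurableType d}.
Variable n : nat.

Let coord : 'I_n -> 'rV[T]_n -> T := fun i x => x ord0 i.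

Let rV_set0 : g_sigma_preimage coord set0.
Proof. exact: sigma_algebra0. Qed.

Let rV_setC A : g_sigma_preimage coord A -> g_sigma_preimage coord (~` A).
Proof. exact: sigma_algebraC. Qed.

Let rV_bigcup (F : (set 'rV[T]_n)^nat) :
  (forall i, g_sigma_preimage coord (F i)) ->
  g_sigma_preimage coord (\bigcup_i (F i)).
Proof. exact: sigma_algebra_bigcup. Qed.

HB.instance Definition _ := @isMeasurable.Build (measure_tuple_display d)
  'rV[T]_n (g_sigma_preimage coord) rV_set0 rV_setC rV_bigcup.

Lemma measurable_coord (i : 'I_n) :
  measurable_fun [set: 'rV[T]_n] (fun x => x ord0 i).
Proof.
move=> _ Y mY; rewrite setTI; apply: sub_sigma_algebra => /=.
rewrite -bigcup_seq/=; exists i => /=; first by rewrite mem_index_enum.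
by exists Y => //; rewrite setTI.
Qed.

Lemma measurable_fun_coord d' (T' : measurableType d') (f : T' -> 'rV[T]_n) :
  (forall i, measurable_fun setT (fun x => f x ord0 i)) ->
  measurable_fun [set: T'] f.
Proof.
move=> mf; apply: (@measurability _ _ T' 'rV[T]_n setT f
  (\big[setU/set0]_(i < n) preimage_set_system setT (coord i) measurable)) => //.
move=> _ [A + <-]; rewrite -bigcup_seq => -[i _ [B mB <-]].
by rewrite !setTI; have := mf i measurableT B mB; rewrite setTI.
Qed.

End measurable_rV.

Section lebesgue_measure_rV.
Context {R : realType}.

Definition cons_rV n (p : measurableTypeR R * 'rV[R]_n) : 'rV[R]_n.+1 :=
  \row_j if unlift ord0 j is Some i then p.2 ord0 i else p.1.

Lemma measurable_cons_rV n : measurable_fun setT (@cons_rV n).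
Proof.
apply: measurable_fun_coord => j.
under eq_fun do rewrite mxE.
case: (unlift ord0 j) => [i|]; last exact: measurable_fst.
exact: (measurableT_comp (measurable_coord i) measurable_snd).
Qed.

Section step.
Variables (n : nat) (mu : {sigma_finite_measure set 'rV[R]_n -> \bar R}).

Definition lebesgue_prod : set 'rV[R]_n.+1 -> \bar R :=
  pushforward (@lebesgue_measure R \x mu)%E (@cons_rV n).


Let m : {measure set 'rV[R]_n.+1 -> \bar R} :=
  measure_function_pushforward__canonical__measure_function_Measure
    (product_measure1 (@lebesgue_measure R) mu) (measurable_cons_rV (n := n)).

HB.instance Definition _ := isMeasure.Build _ _ _ lebesgue_prod
  (measure0 m) (measure_ge0 m) (@measure_semi_sigma_additive _ _ _ m).

Let tail_rV (x : 'rV[R]_n.+1) : measurableTypeR R * 'rV[R]_n :=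
  (x ord0 ord0, \row_i x ord0 (lift ord0 i)).

Let measurable_tail_rV : measurable_fun setT tail_rV.
Proof.
apply: measurable_fun_pair; first exact: measurable_coord.
apply: measurable_fun_coord => i; under eq_fun do rewrite mxE.
exact: measurable_coord.
Qed.

Let cons_rVK : cancel (@cons_rV n) tail_rV.
Proof.
move=> [a v]; rewrite /tail_rV mxE unlift_none; congr pair.
by apply/rowP => i; rewrite !mxE liftK.
Qed.

Let sigma_finite_lebesgue_prod : sigma_finite setT lebesgue_prod.
Proof.
have /sigma_finiteP[F [FT ndF Foo]] := sigma_finiteT (@lebesgue_measure R).
have /sigma_finiteP[G [GT ndG Goo]] := sigma_finiteT mu.
exists (fun k => tail_rV @^-1` (F k `*` G k)) => [|k].
  rewrite -preimage_bigcup (_ : \bigcup_i _ = setT) ?preimage_setT//.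
  apply/seteqP; split => // -[x y] _.
  have [i _ Fx] : (\bigcup_i F i) x by rewrite -FT.
  have [j _ Gy] : (\bigcup_i G i) y by rewrite -GT.
  exists (maxn i j) => //; split => /=.
  - by move: x Fx; exact/subsetPset/ndF/leq_maxl.
  - by move: y Gy; exact/subsetPset/ndG/leq_maxr.
have [mF Fk] := Foo k; have [mG Gk] := Goo k; split.
  rewrite -[X in measurable X]setTI; apply: measurable_tail_rV => //.
  exact: measurableX.
rewrite /lebesgue_prod /pushforward -comp_preimage.
rewrite (_ : _ \o _ = id); last by apply/funext => p /=; rewrite cons_rVK.
by rewrite preimage_id [ltLHS]product_measure1E// lte_mul_pinfty// ge0_fin_numE.
Qed.

HB.instance Definition _ := Measure_isSigmaFinite.Build _ _ _ lebesgue_prod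
  sigma_finite_lebesgue_prod.

End step.

Fixpoint lebesgue_rV n : {sigma_finite_measure set 'rV[R]_n -> \bar R} :=
  match n with
  | 0 => \d_(0 : 'rV[R]_0)
  | m.+1 => lebesgue_prod (lebesgue_rV m)
  end.

Lemma lebesgue_rV_box n (a b : 'I_n -> R) : (forall i, a i <= b i) ->
  lebesgue_rV n [set x | forall i, x ord0 i \in `]a i, b i]] =
  (\prod_i (b i - a i))%:E.
Proof.
elim: n a b => [|n IH] a b ab.
  rewrite big_ord0 /= diracE mem_set//= => -[].
  by case.
pose B : set 'rV[R]_n :=
  [set x | forall i, x ord0 i \in `]a (lift ord0 i), b (lift ord0 i)]].
have preE : @cons_rV n @^-1` [set x | forall i, x ord0 i \in `]a i, b i]] =
    [set` `]a ord0, b ord0]] `*` B.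
  apply/seteqP; split => [[u v] /= H|[u v] /= [H0 H1] i].
    split; first by have := H ord0; rewrite mxE unlift_none.
    by move=> i; have := H (lift ord0 i); rewrite mxE liftK.
  rewrite mxE; case: unliftP => [j ->|->] //; exact: H1.
have mB : measurable B.
  rewrite (_ : B = \big[setI/setT]_(i < n) ((fun x : 'rV[R]_n => x ord0 i)
    @^-1` [set` `]a (lift ord0 i), b (lift ord0 i)]])).
    apply: bigsetI_measurable => i _; rewrite -[X in measurable X]setTI.
    exact: measurable_coord.
  rewrite -bigcap_seq; apply/seteqP; split => x /= H i; first by move=> _; exact: H.
  by apply: H; rewrite /= mem_index_enum.
rewrite -[LHS]/(product_measure1 lebesgue_measure (lebesgue_rV n)
  (@cons_rV n @^-1` _)) preE [LHS]product_measure1E//.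
rewrite [X in (_ * X)%E]IH// big_ord_recl EFinM; congr (_ * _)%E.
rewrite [LHS]lebesgue_measure_itv/= lte_fin; case: ltP => //.
by move=> ba; rewrite (@le_anti _ _ (a ord0) (b ord0)) ?subrr ?ab.
Qed.

End lebesgue_measure_rV.

Section euclidean_space.
Context {R : realType} {d : nat}.
Implicit Types (x y z : 'rV[R]_d) (A Omega : set 'rV[R]_d).

Definition dotr x y : R := \sum_i x ord0 i * y ord0 i.

(* `|x| would be the library's sup norm on matrices; the topology and the     *)
(* bounded sets of 'rV[R]_d are the same for both norms.                      *)
Definition enorm x : R := Num.sqrt (dotr x x).

Definition is_domain Omega := [/\ open Omega, connected Omega & Omega !=set0].

Definition boundary A : set 'rV[R]_d := closure A `\` interior A.

End euclidean_space.

Section point_sets.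
Context {R : realType} {d n : nat}.
Implicit Types (X : 'I_n -> 'rV[R]_d) (Omega : set 'rV[R]_d).

(* Over a finite nonempty set of reals, inf is the minimum. *)
Definition separation_distance X : R :=
  2^-1 * inf [set r | exists i j, X i != X j /\ r = enorm (X i - X j)].

Definition dist_boundary X Omega : R :=
  inf [set r | exists i y, boundary Omega y /\ r = enorm (X i - y)].

End point_sets.

Section kernels.
Context {R : realType} {d : nat}.
Implicit Types (Phi Phihat : 'rV[R]_d -> R) (k : 'rV[R]_d -> 'rV[R]_d -> R).
Local Open Scope complex_scope.

Definition translational_invariant_kernel k Phi :=
  (forall x z, k x z = k z x) /\ (forall x z, k x z = Phi (x - z)).

(* e^(it) *)
Definition cexpi (t : R) : R[i] := cos t +i* sin t.

Definition complex_integral (f : 'rV[R]_d -> R[i]) : R[i] :=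
  (\int[lebesgue_rV d]_w complex.Re (f w)) +i* (\int[lebesgue_rV d]_w complex.Im (f w)).

Definition is_fourier_transform Phi Phihat :=
  (lebesgue_rV d).-integrable setT (EFin \o Phihat) /\
  forall x, (Phi x)%:C = ((2 * pi) `^ (- (d%:R / 2)))%:C *
    complex_integral (fun w => (Phihat w)%:C * cexpi (dotr w x)).

Definition conv_kernel (Omega : set 'rV[R]_d) k x z : R :=
  \int[lebesgue_rV d]_(y in Omega) (k x y * k y z).

Definition kernel_matrix n k (X : 'I_n -> 'rV[R]_d) : 'M[R]_n :=
  \matrix_(i, j) k (X i) (X j).

End kernels.

Section condition_number.
Context {R : realType} {n : nat}.
Implicit Types A : 'M[R]_n.

Definition sym_posdef A :=
  A^T = A /\ forall v : 'rV[R]_n, v != 0 -> 0 < (v *m A *m v^T) ord0 ord0.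

Definition lambda_max A : R := sup [set a | eigenvalue A a].
Definition lambda_min A : R := inf [set a | eigenvalue A a].

(* Only meaningful when sym_posdef A. *)
Definition cond A : R := lambda_max A / lambda_min A.

End condition_number.

(* Main.v *)
Require Import Defs.
From mathcomp Require Import all_boot all_order all_algebra.
From mathcomp Require Import all_classical all_reals all_analysis.
From mathcomp Require Import measurable_realfun complex ring lra.
Import Order.TTheory GRing.Theory Num.Theory.
Import numFieldNormedType.Exports.
Local Open Scope classical_set_scope.
Local Open Scope ring_scope.
Set Implicit Arguments.
Unset Strict Implicit.
Unset Printing Implicit Defensive.

(** Write [f := sum_i v_i Phi(x_i - .)].  The quadratic form of the kernel
    matrix is the squared norm of [f] in [L^2(Omega)], so the smallest
    eigenvalue is controlled from below by testing [f] against a function [g]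
    supported in [Omega] (duality): [int f g >= A |v|^2] and
    [int g^2 <= b |v|^2] give the bound [A^2 / b] ([kernel_form_ge]).

    The test function is [g := sum_j v_j T(. - x_j)], where [T] is a product of
    tent functions supported in a cube whose side is a small multiple of [q].
    The cubes around the points are disjoint and contained in [Omega], so [g]
    vanishes outside [Omega] and [int g^2] has order [s^d |v|^2], [s] being the
    scale of the tents, proportional to [q] ([Rintegral_bump_sum_sqr]).  By
    Fubini, [int f g] is, up to a constant,
      [int Phihat(w) That(w) |sum_j v_j exp(i w.x_j)|^2 dw]
    with [That(w) = prod_k 2s sinc(s w_k)^2], which is nonnegative.  Since
    [sinc(u)^2 <= 2 / (1 + u^2)], an integer [m >= tau] gives
      [Phihat(w) That(w) >= const s^(2 tau + d) prod_k sinc(s w_k)^(2m+2)]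
    ([symbol_ge]).  Positivity of the trigonometric square allows this
    replacement inside the integral, and the cosine transform of [sinc^(2m+2)]
    is supported in [[-(2m+2), 2m+2]] ([Rintegral_sinc_cos_eq0]): for points
    that are far apart with respect to [s] all off-diagonal terms vanish, and
    what remains is [const s^(2 tau) |v|^2] ([pairing_lower]).

    The support property reduces to scaling.  For the square of sinc it
    follows from [int (1 - cos(a u)) / u^2 du = |a| int sinc^2], a change
    of scale, because [sinc(u)^2 cos(z u)] is a second difference of such
    integrands in [a]; multiplication by a further sinc averages the transform
    over a window of length 2 and enlarges the support by 1.

    For the largest eigenvalue, [Phi] is bounded and Cauchy-Schwarz gives
    [O(n)] ([kernel_form_le]); the disjoint cubes give [n s^d = O(vol Omega)]
    ([packing_bound]).  In the quotient of both bounds the powers [s^d] cancel,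
    and [s^(-4 tau)] is left.  That [q] is positive, and that the cubes lie in
    [Omega], comes from the fact that a segment leaving [Omega] meets its
    boundary ([segment_meets_boundary]). *)

(** * Integrability, Fubini and affine substitution *)

Section RealIntegrable.
Context d (T : measurableType d) (R : realType) (mu : {measure set T -> \bar R}).
Implicit Types (D : set T) (f g : T -> R).

Lemma integrable_measurable D f : measurable D -> mu.-integrable D (EFin \o f) ->
  measurable_fun D f.
Proof. by move=> mD /measurable_int/measurable_EFinP. Qed.

Lemma dominated_integrable D f g : measurable D -> measurable_fun D f ->
  mu.-integrable D (EFin \o g) -> (forall x, D x -> `|f x| <= g x) ->
  mu.-integrable D (EFin \o f).
Proof.
move=> mD mf ig fg; apply: (le_integrable mD _ _ ig).
  exact/measurable_EFinP.
move=> x Dx /=; rewrite lee_fin; apply: le_trans (fg _ Dx) _; exact: ler_norm.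
Qed.

Lemma integrable_mul_bounded D f g : measurable D -> mu.-integrable D (EFin \o f) ->
  measurable_fun D g -> (forall x, D x -> `|g x| <= 1) ->
  mu.-integrable D (EFin \o (fun x => f x * g x)).
Proof.
move=> mD intf mg g1.
apply: (@dominated_integrable D (fun x => f x * g x) (fun x => `|f x|)) => //.
- by apply: measurable_funM => //; exact: integrable_measurable.
- exact: integrable_norm.
- by move=> x Dx; rewrite normrM ler_piMr// g1.
Qed.

Lemma EFin_integrableZl D (c : R) f : measurable D ->
  mu.-integrable D (EFin \o f) -> mu.-integrable D (EFin \o (fun x => c * f x)).
Proof.
move=> mD intf; have := integrableZl mD c intf.
by apply: eq_integrable => // x _; rewrite /= EFinM.
Qed.

Lemma EFin_integrableD D f g : measurable D ->
  mu.-integrable D (EFin \o f) -> mu.-integrable D (EFin \o g) ->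
  mu.-integrable D (EFin \o (fun x => f x + g x)).
Proof.
move=> mD intf intg; have := integrableD mD intf intg.
by apply: eq_integrable => // x _; rewrite /= EFinD.
Qed.

Lemma EFin_integrableB D f g : measurable D ->
  mu.-integrable D (EFin \o f) -> mu.-integrable D (EFin \o g) ->
  mu.-integrable D (EFin \o (fun x => f x - g x)).
Proof.
move=> mD intf intg; have := integrableB mD intf intg.
by apply: eq_integrable => // x _; rewrite /= EFinB.
Qed.

(** Integrability and the value are proved together, since additivity of the
    integral needs the former at each step. *)
Lemma Rintegral_sum (I : finType) D (h : I -> T -> R) : measurable D ->
  (forall i, mu.-integrable D (EFin \o h i)) ->
  mu.-integrable D (EFin \o (fun x => \sum_i h i x)) /\
  \int[mu]_(x in D) (\sum_i h i x) = \sum_i \int[mu]_(x in D) h i x.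
Proof.
move=> mD ih.
have H (s : seq I) : mu.-integrable D (EFin \o (fun x => \sum_(i <- s) h i x)) /\
    \int[mu]_(x in D) (\sum_(i <- s) h i x) = \sum_(i <- s) \int[mu]_(x in D) h i x.
  elim: s => [|i s [IH1 IH2]].
    split.
      by under eq_fun do rewrite big_nil; exact: integrable0.
    rewrite big_nil; under eq_Rintegral do rewrite big_nil.
    by rewrite /Rintegral integral0.
  split.
    have := EFin_integrableD mD (ih i) IH1.
    by apply: eq_integrable => // x _ /=; rewrite big_cons.
  rewrite big_cons -IH2 -RintegralD//.
  by apply: eq_Rintegral => x _; rewrite big_cons.
exact: H.
Qed.

End RealIntegrable.

(** Fubini's theorem for an integrand dominated by a product of integrable
    functions: integrability on the product space then follows from Tonelli, and
    every slice is integrable, not only almost every one, so that the statements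
    can be made with real-valued integrals. *)
Section Fubini.
Context d1 d2 (T1 : measurableType d1) (T2 : measurableType d2) (R : realType).
Variables (m1 : {sigma_finite_measure set T1 -> \bar R})
  (m2 : {sigma_finite_measure set T2 -> \bar R}).
Variables (f : T1 * T2 -> R) (g1 : T1 -> R) (g2 : T2 -> R).
Hypotheses (mf : measurable_fun setT f)
  (ig1 : m1.-integrable setT (EFin \o g1)) (ig2 : m2.-integrable setT (EFin \o g2))
  (fg : forall x y, `|f (x, y)| <= g1 x * g2 y).

Lemma integrable_prod_dominated : (m1 \x m2)%E.-integrable setT (EFin \o f).
Proof.
apply/integrable12ltyP; first exact/measurable_EFinP.
have [mg1 +] := integrableP _ _ _ ig1; have [mg2 +] := integrableP _ _ _ ig2.
move=> g2oo g1oo.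
apply: (@le_lt_trans _ _ (\int[m1]_x \int[m2]_y (`|(g1 x)%:E| * `|(g2 y)%:E|))%E).
  apply: ge0_le_integral => //.
  - by move=> x _; exact: integral_ge0.
  - apply: (measurable_fun_fubini_tonelli_F (abse \o (EFin \o f))) => //=.
    by apply: measurableT_comp => //; exact/measurable_EFinP.
  - apply: (measurable_fun_fubini_tonelli_F
      (fun p => `|(g1 p.1)%:E| * `|(g2 p.2)%:E|)%E) => /=.
      apply: emeasurable_funM.
        exact: (measurableT_comp (measurableT_comp (@abse_measurable R setT) mg1)
          measurable_fst).
      exact: (measurableT_comp (measurableT_comp (@abse_measurable R setT) mg2)
          measurable_snd).
    by move=> x; rewrite mule_ge0.
  - move=> x _; apply: ge0_le_integral => //.
    + apply: measurableT_comp => //; apply/measurable_EFinP.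
      exact: measurable_fun_pair2.
    + apply: emeasurable_funM; first exact: measurable_cst.
      exact: measurableT_comp.
    + move=> y _ /=; rewrite -EFinM lee_fin; apply: le_trans (fg _ _) _.
      by rewrite -normrM ler_norm.
rewrite (_ : (\int[m1]_x _)%E =
    (\int[m1]_x (`|(g1 x)%:E| * \int[m2]_y `|(g2 y)%:E|))%E); last first.
  by apply: eq_integral => x _; rewrite ge0_integralZl//; exact: measurableT_comp.
rewrite ge0_integralZr//; [|exact: measurableT_comp|exact: integral_ge0].
by rewrite lte_mul_pinfty// ?integral_ge0// ge0_fin_numE ?integral_ge0.
Qed.

Lemma integrable_dominated_slice1 x : m2.-integrable setT (EFin \o (fun y => f (x, y))).
Proof.
apply: (@dominated_integrable _ _ _ _ _ _ (fun y => g1 x * g2 y)) => //.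
- exact: measurable_fun_pair2.
- exact: EFin_integrableZl.
Qed.

Lemma integrable_dominated_slice2 y : m1.-integrable setT (EFin \o (fun x => f (x, y))).
Proof.
apply: (@dominated_integrable _ _ _ _ _ _ (fun x => g1 x * g2 y)) => //.
- exact: measurable_fun_pair1.
- rewrite (_ : (fun x => _) = (fun x => g2 y * g1 x)).
    exact: EFin_integrableZl.
  by apply/funext => x; rewrite mulrC.
Qed.

Let slice1E x : (\int[m2]_y (f (x, y))%:E)%E = (\int[m2]_y f (x, y))%:E.
Proof.
rewrite /Rintegral fineK//; apply: integrable_fin_num => //.
exact: integrable_dominated_slice1.
Qed.

Let slice2E y : (\int[m1]_x (f (x, y))%:E)%E = (\int[m1]_x f (x, y))%:E.
Proof.
rewrite /Rintegral fineK//; apply: integrable_fin_num => //.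
exact: integrable_dominated_slice2.
Qed.

Lemma integrable_dominated_int1 :
  m1.-integrable setT (EFin \o (fun x => \int[m2]_y f (x, y))).
Proof.
have := integrable_fubini_F integrable_prod_dominated.
by apply: eq_integrable => // x _; rewrite /fubini_F slice1E.
Qed.

Lemma Rintegral_prod_dominated :
  \int[(m1 \x m2)%E]_p f p = \int[m1]_x \int[m2]_y f (x, y).
Proof.
rewrite {1}/Rintegral -integral12_prod_meas1; last exact: integrable_prod_dominated.
by congr fine; apply: eq_integral => x _; rewrite /fubini_F slice1E.
Qed.

Lemma Fubini_dominated :
  \int[m1]_x \int[m2]_y f (x, y) = \int[m2]_y \int[m1]_x f (x, y).
Proof.
rewrite {1}/Rintegral.
transitivity (fine (\int[m1]_x \int[m2]_y (f (x, y))%:E)%E).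
  by congr fine; apply: eq_integral => x _; rewrite slice1E.
rewrite (@Fubini _ _ _ _ _ m1 m2 (EFin \o f))//; last exact: integrable_prod_dominated.
by congr fine; apply: eq_integral => x _; rewrite slice2E.
Qed.

End Fubini.

Section Affine.
Context {R : realType}.
Local Notation mu := (@lebesgue_measure R).
Variables (a b : R).
Hypothesis a0 : a != 0.
Let aff : measurableTypeR R -> measurableTypeR R := fun x => a * x + b.

Let maff : measurable_fun setT aff.
Proof. by apply: measurable_funD => //; exact: measurable_funM. Qed.

Let push : {measure set (measurableTypeR R) -> \bar R} :=
  measure_function_pushforward__canonical__measure_function_Measure mu maff.

Let nua : {measure set (measurableTypeR R) -> \bar R} := mscale (`|a|%:nng) push.

(* Both measures agree on half-open intervals, which determine Lebesgue measure. *)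
Let nuaE A : measurable A -> mu A = nua A.
Proof.
move=> mA; apply: lebesgue_measure_unique => //= _ [[u v]] _ <- /=.
rewrite /nua /mscale/= /pushforward.
have [a_lt0|a_gt0|/eqP] := ltrgtP a 0; last by rewrite (negbTE a0).
- rewrite (_ : aff @^-1` _ = [set` `[(v - b) / a, (u - b) / a[]).
    rewrite !lebesgue_measure_itv/= !lte_fin ltr_ndivrMr// divfK// ltrD2r.
    case: ifP => _; last by rewrite mule0.
    rewrite -!EFinD -EFinM; congr EFin; rewrite ltr0_norm//; field; exact: a0.
  apply/seteqP; split => x /=; rewrite !in_itv/= /aff => /andP[x1 x2].
    by rewrite ler_ndivrMr// ltr_ndivlMr//; apply/andP; split; lra.
  by move: x1 x2; rewrite ler_ndivrMr// ltr_ndivlMr// => x1 x2; apply/andP; split; lra.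
- rewrite (_ : aff @^-1` _ = [set` `](u - b) / a, (v - b) / a]]).
    rewrite !lebesgue_measure_itv/= !lte_fin ltr_pdivrMr// divfK// ltrD2r.
    case: ifP => _; last by rewrite mule0.
    rewrite -!EFinD -EFinM; congr EFin; rewrite gtr0_norm//; field; exact: a0.
  apply/seteqP; split => x /=; rewrite !in_itv/= /aff => /andP[x1 x2].
    by rewrite ltr_pdivrMr// ler_pdivlMr//; apply/andP; split; lra.
  by move: x1 x2; rewrite ltr_pdivrMr// ler_pdivlMr// => x1 x2; apply/andP; split; lra.
Qed.

Let ge0_affine (f : measurableTypeR R -> \bar R) : measurable_fun setT f ->
  (forall x, 0 <= f x)%E ->
  (\int[mu]_x f x = `|a|%:E * \int[mu]_x f (aff x))%E.
Proof.
move=> mf f0.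
transitivity (\int[nua]_x f x)%E.
  by apply: eq_measure_integral => A mA _; exact: nuaE.
rewrite ge0_integral_mscale//=; congr (_ * _)%E.
by rewrite (ge0_integral_pushforward maff)// preimage_setT.
Qed.

Let integrable_affineE (f : measurableTypeR R -> R) : measurable_fun setT f ->
  mu.-integrable setT (EFin \o f) <->
  mu.-integrable setT (EFin \o (fun x => f (a * x + b))).
Proof.
move=> mf.
have key : (\int[mu]_x `|(f x)%:E| = `|a|%:E * \int[mu]_x `|(f (aff x))%:E|)%E.
  by apply: ge0_affine => //; apply: measurableT_comp => //; exact/measurable_EFinP.
have pos : (0 < `|a|%:E)%E by rewrite lte_fin normr_gt0.
split=> /integrableP[_ foo]; apply/integrableP; split.
- by apply/measurable_EFinP; exact: (measurableT_comp mf maff).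
- move: foo; rewrite [X in (X < _)%E -> _]key => foo.
  rewrite ltey; apply: contraTN foo => /eqP ->.
  by rewrite gt0_muley// ltxx.
- exact/measurable_EFinP.
- rewrite [X in (X < _)%E]key lte_mul_pinfty//.
Qed.

Lemma integrable_affine (f : measurableTypeR R -> R) : mu.-integrable setT (EFin \o f) ->
  mu.-integrable setT (EFin \o (fun x => f (a * x + b))).
Proof.
by move=> fi; apply/(integrable_affineE (integrable_measurable measurableT fi)).1.
Qed.

Lemma Rintegral_affine (f : measurableTypeR R -> R) : mu.-integrable setT (EFin \o f) ->
  \int[mu]_x f x = `|a| * \int[mu]_x f (a * x + b).
Proof.
move=> fi; have fai := integrable_affine fi.
have mf := integrable_measurable measurableT fi.
rewrite -[`|a|]/(fine `|a|%:E) /Rintegral -fineM//; last exact: integrable_fin_num.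
congr fine; rewrite (integralE _ _ (EFin \o f)) [X in _ = (_ * X)%E]integralE.
rewrite muleBr//; last first.
  by rewrite fin_num_adde_defl// fin_numN; exact: integrable_neg_fin_num fai.
congr (_ - _)%E.
- rewrite (@ge0_affine ((EFin \o f)^\+)%E)//.
  + congr (_ * _)%E; apply: eq_integral => x _.
    by rewrite ?funeposE ?funenegE.
  + exact/measurable_funepos/measurable_EFinP.
- rewrite (@ge0_affine ((EFin \o f)^\-)%E)//.
  + congr (_ * _)%E; apply: eq_integral => x _.
    by rewrite ?funeposE ?funenegE.
  + exact/measurable_funeneg/measurable_EFinP.
Qed.

End Affine.

Lemma Rintegral_opp {R : realType} (g : measurableTypeR R -> R) :
  (@lebesgue_measure R).-integrable setT (EFin \o g) ->
  (@lebesgue_measure R).-integrable setT (EFin \o (fun y => g (- y))) /\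
  \int[@lebesgue_measure R]_y g (- y) = \int[@lebesgue_measure R]_y g y.
Proof.
move=> ig; have n1 : -1 != 0 :> R by rewrite oppr_eq0 oner_eq0.
have E : (fun y => g (- y)) = (fun y => g (- 1 * y + 0)).
  by apply/funext => y; rewrite mulN1r addr0.
split; first by rewrite E; exact: integrable_affine.
by rewrite (Rintegral_affine 0 n1 ig) normrN1 mul1r E.
Qed.

(** * Calculus on the line and the function sinc *)

Section Calculus.
Context {R : realType}.
Local Notation mu := (@lebesgue_measure R).
Implicit Types (f g F : R -> R) (a b u x z : R).

(** The real power [t `^ (-1)] is measurable in [t] and vanishes at 0, as the
    inverse does, so [x^-1 = x * (x ^+ 2) `^ (-1)] holds at 0 as well. *)
Lemma measurable_inv : measurable_fun setT (fun x : R => x^-1).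
Proof.
rewrite (_ : (fun x => _) = (fun x => x * (x ^+ 2) `^ (-1))); last first.
  apply/funext => x; rewrite powR_inv1 ?sqr_ge0//.
  have [->|x0] := eqVneq x 0; first by rewrite invr0 mul0r.
  by field.
apply: measurable_funM => //.
exact: (measurableT_comp (measurable_powR (- 1)) (exprn_measurable 2)).
Qed.

Lemma measurable_cos : measurable_fun setT (@cos R).
Proof. by apply: continuous_measurable_fun; exact: continuous_cos. Qed.

Lemma measurable_sin : measurable_fun setT (@sin R).
Proof. by apply: continuous_measurable_fun; exact: continuous_sin. Qed.

Lemma Rintegral_FTC2 F f a b : a <= b -> (forall x, is_derive x 1 F (f x)) ->
  continuous f -> \int[mu]_(x in `[a, b]) f x = F b - F a.
Proof.
rewrite le_eqVlt => /predU1P[<-|ab] dF cf.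
  by rewrite set_itv1 Rintegral_set1 subrr.
have cF : continuous F.
  by move=> x; apply/differentiable_continuous/derivable1_diffP; have [] := dF x.
rewrite /Rintegral (@continuous_FTC2 _ f F)//.
- by apply: continuous_in_subspaceT => x _; exact: cf.
- split; first by move=> x _; have [] := dF x.
  + exact/cvg_at_right_filter/cF.
  + exact/cvg_at_left_filter/cF.
- by move=> x _; rewrite derive1E; have [_ ->] := dF x.
Qed.

Lemma sin_le_id u : 0 <= u -> `|sin u| <= u.
Proof.
move=> u0.
have cs : {within `[0, u], continuous (@sin R)}.
  by apply: continuous_subspaceT => x; exact: continuous_sin.
have [c _] := @MVT_segment R sin cos 0 u u0 (fun x _ => is_derive_sin x) cs.
rewrite sin0 !subr0 => ->; rewrite normrM (ger0_norm u0).
by rewrite ler_piMl// cos_max.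
Qed.

Lemma normr_sin_le u : `|sin u| <= `|u|.
Proof.
have [u0|u0] := leP 0 u; first by rewrite (ger0_norm u0) sin_le_id.
by rewrite (ltr0_norm u0) -normrN -sinN sin_le_id// oppr_ge0 ltW.
Qed.

(** The value at the origin is 0 instead of 1.  This is immaterial for integrals,
    and the pointwise identities between positive powers of sinc used below hold at
    the origin thanks to it. *)
Definition sinc u := sin u / u.

Lemma measurable_sinc : measurable_fun setT sinc.
Proof. apply: measurable_funM; [exact: measurable_sin|exact: measurable_inv]. Qed.

Lemma normr_sinc_le1 u : `|sinc u| <= 1.
Proof.
have [->|u0] := eqVneq u 0; first by rewrite /sinc invr0 mulr0 normr0.
by rewrite /sinc normrM normfV ler_pdivrMr ?normr_gt0// mul1r normr_sin_le.
Qed.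

(** The sum of [sinc^2 <= 1] and [u^2 sinc^2 = sin^2 <= 1]. *)
Lemma sinc_sqr_le u : sinc u ^+ 2 <= 2 / (1 + u ^+ 2).
Proof.
have p : 0 < 1 + u ^+ 2 by rewrite ltr_pwDl// sqr_ge0.
rewrite ler_pdivlMr// mulrDr mulr1.
have s1 : sinc u ^+ 2 <= 1.
  by rewrite -[leLHS]ger0_norm ?sqr_ge0// normrX exprn_ile1// normr_sinc_le1.
suff : sinc u ^+ 2 * u ^+ 2 <= 1 by lra.
rewrite -exprMn /sinc; have [->|u0] := eqVneq u 0.
  by rewrite mulr0 expr0n.
by rewrite divfK// sin2cos2 gerBl sqr_ge0.
Qed.

Lemma integrable_oneDsqrV : mu.-integrable setT (EFin \o (fun x : R => (1 + x ^+ 2)^-1)).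
Proof.
have c : continuous (fun x : R => (1 + x ^+ 2)^-1) by exact: continuous_oneDsqrV.
apply/integrableP; split.
  by apply/measurable_EFinP; exact: continuous_measurable_fun.
rewrite (_ : (\int[mu]_x _)%E = (\int[mu]_x (1 + x ^+ 2)^-1%:E)%E); last first.
  by apply: eq_integral => x _; rewrite /= ger0_norm// invr_ge0 addr_ge0// sqr_ge0.
rewrite ge0_symfun_integralT//.
- rewrite (_ : [set x | _] = `[0, +oo[%classic); last first.
    by apply/seteqP; split => x /=; rewrite in_itv/= andbT.
  by rewrite [X in (_ * X)%E]integral0y_oneDsqr -EFinM ltry.
- by move=> x; rewrite invr_ge0 addr_ge0// sqr_ge0.
- by move=> x /=; rewrite sqrrN.
Qed.

Lemma integrable_sinc_pow k : mu.-integrable setT (EFin \o (fun u => sinc u ^+ k.+2)).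
Proof.
apply: (@dominated_integrable _ _ R mu setT (fun u => sinc u ^+ k.+2)
  (fun u => 2 * (1 + u ^+ 2)^-1)) => //.
- exact: (measurable_funX _ measurable_sinc).
- apply: EFin_integrableZl => //; exact: integrable_oneDsqrV.
- move=> u _; apply: le_trans (sinc_sqr_le u); rewrite -(real_normK (num_real _)) normrX.
  by rewrite -addn2 exprD ler_piMl ?sqr_ge0// exprn_ile1// normr_sinc_le1.
Qed.

Lemma integrable_sinc_cos k z : mu.-integrable setT
  (EFin \o (fun u => sinc u ^+ k.+2 * cos (z * u))).
Proof.
apply: integrable_mul_bounded => //; first exact: integrable_sinc_pow.
  by apply: (measurableT_comp measurable_cos); exact: measurable_funM.
by move=> u _; exact: cos_max.
Qed.

Lemma integrable_sinc_sin k z : mu.-integrable setT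
  (EFin \o (fun u => sinc u ^+ k.+2 * sin (z * u))).
Proof.
apply: integrable_mul_bounded => //; first exact: integrable_sinc_pow.
  by apply: (measurableT_comp measurable_sin); exact: measurable_funM.
by move=> u _; exact: sin_max.
Qed.

Lemma Rintegral_sinc_sin k z : \int[mu]_u (sinc u ^+ k.+2 * sin (z * u)) = 0.
Proof.
have i := integrable_sinc_sin k z; have [_ e] := Rintegral_opp i.
suff : \int[mu]_u (sinc u ^+ k.+2 * sin (z * u)) =
    - \int[mu]_u (sinc u ^+ k.+2 * sin (z * u)) by lra.
rewrite -[in LHS]e -mulN1r -RintegralZl//.
by apply: eq_Rintegral => u _; rewrite mulrN /sinc !sinN invrN mulrNN; ring.
Qed.

End Calculus.

(** * Compact support of the cosine transform of powers of sinc *)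

Section SincTransform.
Context {R : realType}.
Local Notation mu := (@lebesgue_measure R).
Implicit Types (a u z t : R).

Lemma cos_double t : cos (2 * t) = 1 - 2 * sin t ^+ 2 :> R.
Proof. by rewrite mulr_natl cos_mulr2n cos2sin2 mulrnBl -[in RHS]mulr_natl; ring. Qed.

(** The integrand is [a^2/2] times [sinc(a u / 2)^2], and a change of scale
    turns the factor [a^2/2] into [|a|]. *)
Lemma integral_one_sub_cos a :
  mu.-integrable setT (EFin \o (fun u => (1 - cos (a * u)) / u ^+ 2)) /\
  \int[mu]_u ((1 - cos (a * u)) / u ^+ 2) = `|a| * \int[mu]_u (sinc u ^+ 2).
Proof.
have is2 : mu.-integrable setT (EFin \o (fun u : R => sinc u ^+ 2)).
  exact: integrable_sinc_pow.
have E : (fun u => (1 - cos (a * u)) / u ^+ 2) =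
    (fun u => a ^+ 2 / 2 * sinc (a / 2 * u + 0) ^+ 2).
  apply/funext => u; rewrite addr0 /sinc (_ : a * u = 2 * (a / 2 * u)); last by field.
  rewrite cos_double; have [->|a0] := eqVneq a 0.
    by rewrite !mul0r sin0 expr0n /= mulr0 subr0 subrr !mul0r.
  have [->|u0] := eqVneq u 0.
    by rewrite !mulr0 !invr0 !mulr0 !expr0n/= invr0 !mulr0.
  by field; apply/andP.
have [->|a0] := eqVneq a 0.
  rewrite normr0 mul0r.
  have E0 : (fun u : R => (1 - cos (0 * u)) / u ^+ 2) = cst 0.
    by apply/funext => u; rewrite mul0r cos0 subrr mul0r.
  split; first by rewrite E0; exact: integrable0.
  by rewrite E0 Rintegral_cst// mul0r.
have a20 : a / 2 != 0 by rewrite mulf_neq0// invr_neq0.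
have ias := integrable_affine 0 a20 is2.
rewrite E; split; first exact: EFin_integrableZl.
rewrite RintegralZl// (Rintegral_affine 0 a20 is2) !mulrA; congr (_ * _).
rewrite normrM normfV normr_nat.
by rewrite -(real_normK (num_real a)); field.
Qed.

(** [4 sin(u)^2 cos(z u)] is the second difference of [- cos(a u)] at the points
    [z - 2], [z], [z + 2].  After integration against [1/u^2] it becomes the
    second difference of [|a|], which vanishes unless the kink at 0 lies between
    the points. *)
Lemma Rintegral_sinc2_cos z : 2 <= `|z| -> \int[mu]_u (sinc u ^+ 2 * cos (z * u)) = 0.
Proof.
move=> z2; set S := \int[mu]_u (sinc u ^+ 2).
have [i0 e0] := integral_one_sub_cos z.
have [i1 e1] := integral_one_sub_cos (z + 2).
have [i2 e2] := integral_one_sub_cos (z - 2).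
under eq_Rintegral => u _.
  rewrite (_ : _ * _ = 2^-1 * (2^-1 * ((1 - cos ((z + 2) * u)) / u ^+ 2)
    + 2^-1 * ((1 - cos ((z - 2) * u)) / u ^+ 2) - (1 - cos (z * u)) / u ^+ 2)).
    over.
  have [->|u0] := eqVneq u 0.
    by rewrite /sinc !mulr0 cos0 sin0 subrr !mul0r expr0n/=; ring.
  by rewrite (mulrDl z 2 u) (mulrBl u z 2) cosD cosB cos_double /sinc; field.
have i12 := EFin_integrableD measurableT
  (EFin_integrableZl 2^-1 measurableT i1) (EFin_integrableZl 2^-1 measurableT i2).
rewrite RintegralZl//; last exact: EFin_integrableB.
rewrite RintegralB// RintegralD//; try exact: EFin_integrableZl.
rewrite !RintegralZl// e0 e1 e2 -/S.
have [z0|z0] := leP 0 z.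
  move: z2; rewrite (ger0_norm z0) => z2; rewrite !ger0_norm; lra.
move: z2; rewrite (ltr0_norm z0) => z2.
rewrite (@ler0_norm _ (z + 2)) ?(@ler0_norm _ (z - 2)); lra.
Qed.

Lemma Rintegral_cos_window z u :
  \int[mu]_(t in `[(- 1), 1]) (cos ((z + t) * u) * u) = 2 * sin u * cos (z * u).
Proof.
have c : continuous (fun t => cos ((z + t) * u) * u).
  move=> t; apply: cvgM; last exact: cvg_cst.
  apply: continuous_comp; last exact: continuous_cos.
  apply: cvgM; last exact: cvg_cst.
  by apply: cvgD; [exact: cvg_cst|exact: cvg_id].
have dF t : is_derive t 1 (fun t => sin ((z + t) * u)) (cos ((z + t) * u) * u).
  by apply: is_derive_eq; rewrite /GRing.scale/=; ring.
rewrite (Rintegral_FTC2 _ dF c)//.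
by rewrite (mulrDl z 1) (mulrDl z (- 1)) mul1r mulN1r sinD sinB; ring.
Qed.
End SincTransform.

Section SincPower.
Context {R : realType}.
Local Notation mu := (@lebesgue_measure R).
Implicit Types (a u z t : R).

(** [sinc(u) cos(z u)] is the mean of [cos((z + t) u)] over [-1 <= t <= 1]; at
    [u = 0] the remaining power of sinc makes both sides vanish. *)
Lemma Rintegral_sinc_cos_succ k z :
  \int[mu]_u (sinc u ^+ k.+3 * cos (z * u)) =
  2^-1 * \int[mu]_(t in `[(- 1), 1]) \int[mu]_u (sinc u ^+ k.+2 * cos ((z + t) * u)).
Proof.
set I : set R := `[(- 1)%R, 1%R]%classic.
pose f (p : measurableTypeR R * measurableTypeR R) : R :=
  sinc p.1 ^+ k.+2 * cos ((z + p.2) * p.1) * \1_I p.2.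
have mf : measurable_fun setT f.
  apply: measurable_funM; last first.
    have mI : measurable_fun setT (\1_I : measurableTypeR R -> R).
      by apply: measurable_indic; exact: measurable_itv.
    exact: (measurableT_comp mI measurable_snd).
  apply: measurable_funM.
    exact: (measurableT_comp (measurable_funX _ measurable_sinc) measurable_fst).
  apply: (measurableT_comp measurable_cos).
  apply: measurable_funM; last exact: measurable_fst.
  by apply: measurable_funD; [exact: measurable_cst|exact: measurable_snd].
have i1 : mu.-integrable setT (EFin \o (fun u : R => `|sinc u ^+ k.+2|)).
  exact/integrable_norm/integrable_sinc_pow.
have i2 : mu.-integrable setT (EFin \o (\1_I : R -> R)).
  exact: integrable_indic_itv.
have fg u t : `|f (u, t)| <= `|sinc u ^+ k.+2| * \1_I t.
  rewrite /f normrM (ger0_norm (_ : 0 <= \1_I t)) ?ler_wpM2r//.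
  by rewrite normrM ler_piMr// cos_max.
have <- : \int[mu]_t \int[mu]_u f (u, t) =
    \int[mu]_(t in I) \int[mu]_u (sinc u ^+ k.+2 * cos ((z + t) * u)).
  rewrite [RHS]Rintegral_mkcond; apply: eq_Rintegral => t _.
  rewrite patch_indic /= -RintegralZr//; exact: integrable_sinc_cos.
have /= <- := Fubini_dominated mf i1 i2 fg.
rewrite -RintegralZl//; last exact: (integrable_dominated_int1 mf i1 i2 fg).
apply: eq_Rintegral => u _.
have -> : \int[mu]_t f (u, t) = \int[mu]_(t in I) (sinc u ^+ k.+2 * cos ((z + t) * u)).
  by rewrite [RHS]Rintegral_mkcond; apply: eq_Rintegral => t _; rewrite patch_indic.
have [->|u0] := eqVneq u 0.
  have s0 : sinc 0 = 0 :> R by rewrite /sinc invr0 mulr0.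
  under eq_Rintegral do rewrite s0 expr0n/= mul0r.
  rewrite s0 !expr0n/= Rintegral_cst; last exact: measurable_itv.
  ring.
under eq_Rintegral => t _.
  rewrite (_ : _ * _ = sinc u ^+ k.+2 / u * (cos ((z + t) * u) * u)); last by field.
  over.
rewrite RintegralZl; [|exact: measurable_itv|].
  by rewrite Rintegral_cos_window exprS {1}/sinc; field.
apply: continuous_compact_integrable; first exact: segment_compact.
apply: continuous_subspaceT => t; apply: cvgM; last exact: cvg_cst.
apply: continuous_comp; last exact: continuous_cos.
apply: cvgM; last exact: cvg_cst.
by apply: cvgD; [exact: cvg_cst|exact: cvg_id].
Qed.

(** The transform of [sinc^k] is supported in [[-k, k]]: each factor is the
    transform of a uniform density on a window of half-length 1. *)
Lemma Rintegral_sinc_cos_eq0 k z : k.+2%:R <= `|z| ->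
  \int[mu]_u (sinc u ^+ k.+2 * cos (z * u)) = 0.
Proof.
elim: k z => [|k IH] z kz; first exact: Rintegral_sinc2_cos.
rewrite Rintegral_sinc_cos_succ.
under eq_Rintegral => t.
  rewrite inE/= in_itv/= => /andP[t1 t2].
  rewrite IH; last first.
    have : `|z| <= `|z + t| + `|t| by rewrite -[z in leLHS](addrK t) ler_normB.
    have : `|t| <= 1 by rewrite ler_norml t1 t2.
    by move: kz; rewrite -(natr1 k.+2); lra.
  over.
by rewrite Rintegral_cst// mul0r mulr0.
Qed.

(** On [(0, 1/2]] the mean value theorem gives [sinc u >= cos(1/2) > 0]. *)
Lemma Rintegral_sinc_gt0 k : ~~ odd k -> 0 < \int[mu]_u (sinc u ^+ k.+2 : R).
Proof.
move=> ek; set h : R := 2^-1.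
have h0 : 0 < h by rewrite invr_gt0.
have hpi : h < pi / 2 by rewrite ltr_pdivlMr// mulVf// (lt_le_trans _ (pi_ge2 _))// ltr1n.
have c1 : 0 < cos h by rewrite cos_gt0_pihalf// hpi andbT; lra.
set I : set R := `]0%R, h]%classic.
have ii : mu.-integrable setT (EFin \o (\1_I : R -> R)) by exact: integrable_indic_itv.
apply: (@lt_le_trans _ _ (\int[mu]_u (cos h ^+ k.+2 * \1_I u))).
  rewrite RintegralZl// mulr_gt0 ?exprn_gt0// /Rintegral integral_indic//; last first.
    exact: measurable_itv.
  rewrite setIT [X in fine X](_ : _ = h%:E)//.
  by rewrite [LHS]lebesgue_measure_itv/= lte_fin h0 oppr0 adde0.
apply: le_Rintegral => //.
- exact: EFin_integrableZl.
- exact: integrable_sinc_pow.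
move=> u _; rewrite indicE; have [|_] := boolP (u \in I); last first.
  by rewrite mulr0; apply: exprn_even_ge0; rewrite /= negbK.
rewrite inE /I /= in_itv/= mulr1 => /andP[u0 u1].
have cs : {within `[0, u], continuous (@sin R)}.
  by apply: continuous_subspaceT => x; exact: continuous_sin.
have [c + E] := @MVT_segment R sin cos 0 u (ltW u0) (fun x _ => is_derive_sin x) cs.
rewrite in_itv/= => /andP[c0' cu].
have -> : sinc u = cos c.
  by move: E; rewrite sin0 !subr0 /sinc => ->; rewrite mulfK// gt_eqF.
have cc : cos h <= cos c.
  rewrite leNgt ltr_cos ?in_itv/=; first by rewrite -leNgt (le_trans cu).
  - lra.
  - lra.
by rewrite lerXn2r ?nnegrE ?(ltW c1)// (le_trans (ltW c1)).
Qed.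

End SincPower.

(** * The tent function and its cosine transform *)

Section Tent.
Context {R : realType}.
Local Notation mu := (@lebesgue_measure R).
Implicit Types (a b s u w x y : R).

(** Half of a tent.  Leaving the origin out makes the sum of the two reflected
    halves an even function bounded by 1, without a separate case at 0. *)
Definition ramp y : R := (1 - y) * \1_(`]0%R, 1%R]%classic : set R) y.
Definition tent y : R := ramp y + ramp (- y).

Lemma rampE y : ramp y = if 0 < y <= 1 then 1 - y else 0.
Proof.
rewrite /ramp indicE; have [|] := boolP (y \in _).
  by rewrite inE/= in_itv/= => ->; rewrite mulr1.
by rewrite notin_setE/= in_itv/= => /negP/negbTE ->; rewrite mulr0.
Qed.

Lemma ramp_ge0 y : 0 <= ramp y.
Proof. by rewrite rampE; case: ifPn => // /andP[_]; rewrite subr_ge0. Qed.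

Lemma tent_ge0 y : 0 <= tent y.
Proof. by rewrite addr_ge0// ramp_ge0. Qed.

Lemma tent_le1 y : tent y <= 1.
Proof.
rewrite /tent !rampE; case: ifPn => [/andP[y0 y1]|_]; case: ifPn => [/andP[z0 z1]|_]; lra.
Qed.

Lemma tent_eq0 y : 1 <= `|y| -> tent y = 0.
Proof.
rewrite ler_normr /tent !rampE => /orP[y1|y1];
  by case: ifPn => [/andP[y0 y2]|_]; case: ifPn => [/andP[z0 z1]|_]; lra.
Qed.

Let ramp_bound y : `|ramp y| <= \1_(`]0%R, 1%R]%classic : set R) y.
Proof.
rewrite ger0_norm ?ramp_ge0// /ramp indicE; have [|] := boolP (y \in _).
  by rewrite inE/= in_itv/= => /andP[y0 y1]; rewrite mulr1 lerBlDr lerDl ltW.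
by rewrite mulr0.
Qed.

Lemma measurable_ramp : measurable_fun setT ramp.
Proof.
apply: measurable_funM; first exact: measurable_funB.
by apply: measurable_indic; exact: measurable_itv.
Qed.

Let integrable_ramp_bounded (g : R -> R) : measurable_fun setT g ->
  (forall y, `|g y| <= 1) -> mu.-integrable setT (EFin \o (fun y => ramp y * g y)).
Proof.
move=> mg g1; apply: integrable_mul_bounded => //.
apply: (@dominated_integrable _ _ R mu setT ramp \1_(`]0%R, 1%R]%classic : set R)).
- exact: measurableT.
- exact: measurable_ramp.
- exact: integrable_indic_itv.
- by move=> y _; exact: ramp_bound.
Qed.

Lemma integrable_tent_bounded (g : R -> R) : measurable_fun setT g ->
  (forall y, `|g y| <= 1) -> mu.-integrable setT (EFin \o (fun y => tent y * g y)).
Proof.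
move=> mg g1.
have i1 := integrable_ramp_bounded mg g1.
have iN : mu.-integrable setT (EFin \o (fun y => ramp y * g (- y))).
  by apply: integrable_ramp_bounded => //; apply: (measurableT_comp mg).
have [i2 _] := Rintegral_opp iN.
have := EFin_integrableD measurableT i1 i2.
by apply: eq_integrable => // y _ /=; rewrite opprK mulrDl.
Qed.

Let measurable_trig (f : R -> R) u : measurable_fun setT f ->
  measurable_fun setT (fun y => f (u * y)).
Proof. by move=> mf; apply: (measurableT_comp mf); exact: measurable_funM. Qed.

Definition tent_hat u := \int[mu]_y (tent y * cos (u * y)).

Lemma integrable_tent_cos u : mu.-integrable setT (EFin \o (fun y => tent y * cos (u * y))).
Proof.
apply: integrable_tent_bounded; first exact: (measurable_trig _ measurable_cos).
by move=> y; exact: cos_max.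
Qed.

Lemma integrable_tent_sin u : mu.-integrable setT (EFin \o (fun y => tent y * sin (u * y))).
Proof.
apply: integrable_tent_bounded; first exact: (measurable_trig _ measurable_sin).
by move=> y; exact: sin_max.
Qed.

Lemma Rintegral_tent_sin u : \int[mu]_y (tent y * sin (u * y)) = 0.
Proof.
have [i e] := Rintegral_opp (integrable_tent_sin u).
suff : \int[mu]_y (tent y * sin (u * y)) = - \int[mu]_y (tent y * sin (u * y)) by lra.
rewrite -[in LHS]e -mulN1r -RintegralZl//; last exact: integrable_tent_sin.
by apply: eq_Rintegral => y _; rewrite mulrN sinN /tent opprK; ring.
Qed.

Let continuous_wedge u : continuous (fun y => (1 - y) * cos (u * y)).
Proof.
move=> y; apply: cvgM; first by apply: cvgB; [exact: cvg_cst|exact: cvg_id].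
apply: continuous_comp; last exact: continuous_cos.
by apply: cvgM; [exact: cvg_cst|exact: cvg_id].
Qed.

Lemma tent_hatE u : tent_hat u = 2 * \int[mu]_(y in `[0, 1]) ((1 - y) * cos (u * y)).
Proof.
have ic : mu.-integrable setT (EFin \o (fun y => ramp y * cos (u * y))).
  apply: integrable_ramp_bounded; first exact: (measurable_trig _ measurable_cos).
  by move=> y; exact: cos_max.
have [i e] := Rintegral_opp ic.
rewrite -Rintegral_itv_obnd_cbnd; last first.
  apply: (@integrableS _ _ _ mu `[0, 1]); [exact: measurable_itv|exact: measurable_itv| |].
    by apply: subset_itvr; rewrite bnd_simp.
  apply: continuous_compact_integrable; first exact: segment_compact.
  by apply: continuous_subspaceT => y; exact: continuous_wedge.
rewrite Rintegral_mkcond /tent_hat.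
transitivity (\int[mu]_y (ramp y * cos (u * y)) + \int[mu]_y (ramp (- y) * cos (u * - y))).
  rewrite -RintegralD//; apply: eq_Rintegral => y _.
  by rewrite mulrN cosN mulrDl.
rewrite e mulr_natl mulr2n; congr (_ + _);
  by apply: eq_Rintegral => y _; rewrite patch_indic/= /ramp; ring.
Qed.

(** Equality holds for [u] different from 0; the inequality covers the origin,
    where sinc has been given the value 0. *)
Lemma tent_hat_ge u : sinc (u / 2) ^+ 2 <= tent_hat u.
Proof.
rewrite tent_hatE; have [->|u0] := eqVneq u 0.
  rewrite /sinc mul0r invr0 mulr0 expr0n/= mulr_ge0// Rintegral_ge0// => y.
  by rewrite /= in_itv/= mul0r cos0 mulr1 subr_ge0 => /andP[].
pose F y := (1 - y) * sin (u * y) / u - cos (u * y) / u ^+ 2.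
have dF y : is_derive y 1 F ((1 - y) * cos (u * y)).
  by apply: is_derive_eq; rewrite /GRing.scale/=; field.
rewrite (Rintegral_FTC2 _ dF (@continuous_wedge u))// /F mulr1 mulr0 cos0 sin0 /sinc.
rewrite [X in cos X](_ : u = 2 * (u / 2)) ?cos_double; last by field.
by rewrite le_eqVlt; apply/orP; left; apply/eqP; field.
Qed.

Lemma tent_hat_ge0 u : 0 <= tent_hat u.
Proof. by apply: le_trans (tent_hat_ge u); exact: sqr_ge0. Qed.

(** The sine integral of a tent centred at 0 vanishes by parity, so only the phase
    at the centre [b] survives. *)
Lemma Rintegral_tent_shift s a b w : 0 < s ->
  \int[mu]_y (tent ((y - b) / s) * cos (w * (a - y))) =
    s * tent_hat (s * w) * cos (w * (a - b)) /\
  \int[mu]_y (tent ((y - b) / s) * sin (w * (a - y))) =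
    s * tent_hat (s * w) * sin (w * (a - b)).
Proof.
move=> s0; have sn0 : s != 0 by rewrite gt_eqF.
have sV0 : s^-1 != 0 by rewrite invr_neq0.
have int (g : R -> R) : measurable_fun setT g -> (forall y, `|g y| <= 1) ->
    \int[mu]_y (tent ((y - b) / s) * g (w * (a - y))) =
    s * \int[mu]_y (tent y * g (w * (a - b) - s * w * y)).
  move=> mg g1; pose G y := tent y * g (w * (a - b) - s * w * y).
  have iG : mu.-integrable setT (EFin \o G).
    apply: (@integrable_tent_bounded (fun y => g (w * (a - b) - s * w * y))) => //.
    apply: (measurableT_comp mg); apply: measurable_funB => //; exact: measurable_funM.
  have := Rintegral_affine (- (b / s)) sV0 iG.
  rewrite /G => ->; rewrite gtr0_norm ?invr_gt0// mulrA divff// mul1r.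
  apply: eq_Rintegral => y _; congr (tent _ * g _); field; exact: sn0.
have ic := integrable_tent_cos (s * w); have is_ := integrable_tent_sin (s * w).
split.
- rewrite (int cos measurable_cos)//; last by move=> y; exact: cos_max.
  rewrite -mulrA; congr (_ * _).
  under eq_Rintegral => y _.
    rewrite (_ : _ * _ = cos (w * (a - b)) * (tent y * cos (s * w * y)) +
      sin (w * (a - b)) * (tent y * sin (s * w * y))); last by rewrite cosB; ring.
    over.
  rewrite RintegralD//; try exact: EFin_integrableZl.
  by rewrite !RintegralZl// Rintegral_tent_sin mulr0 addr0 mulrC.
- rewrite (int sin measurable_sin)//; last by move=> y; exact: sin_max.
  rewrite -mulrA; congr (_ * _).
  under eq_Rintegral => y _.
    rewrite (_ : _ * _ = sin (w * (a - b)) * (tent y * cos (s * w * y)) -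
      cos (w * (a - b)) * (tent y * sin (s * w * y))); last by rewrite sinB; ring.
    over.
  rewrite RintegralB//; try exact: EFin_integrableZl.
  by rewrite !RintegralZl// Rintegral_tent_sin mulr0 subr0 mulrC.
Qed.

End Tent.

(** * Integration of product functions over row vectors *)

Section ProductIntegral.
Context {R : realType}.
Local Notation mu := (@lebesgue_measure R).

Lemma measurable_prod_coord n (p : 'I_n -> R -> R) :
  (forall i, measurable_fun setT (p i)) ->
  measurable_fun setT (fun x : 'rV[R]_n => \prod_i p i (x ord0 i)).
Proof.
move=> mp; apply: measurable_prod => i _.
exact: (measurableT_comp (mp i) (measurable_coord i)).
Qed.

Lemma measurable_sum_coord n (p : 'I_n -> R -> R) :
  (forall i, measurable_fun setT (p i)) ->
  measurable_fun setT (fun x : 'rV[R]_n => \sum_i p i (x ord0 i)).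
Proof.
move=> mp; apply: measurable_sum => i.
exact: (measurableT_comp (mp i) (measurable_coord i)).
Qed.

Lemma cons_rV0 n (x : R) (v : 'rV[R]_n) : cons_rV (x, v) ord0 ord0 = x.
Proof. by rewrite mxE unlift_none. Qed.

Lemma cons_rVS n (x : R) (v : 'rV[R]_n) i : cons_rV (x, v) ord0 (lift ord0 i) = v ord0 i.
Proof. by rewrite mxE liftK. Qed.

Lemma Rintegral_rV0 (f : 'rV[R]_0 -> R) : measurable_fun setT f ->
  (lebesgue_rV 0).-integrable setT (EFin \o f) /\ \int[lebesgue_rV 0]_x f x = f 0.
Proof.
move=> mf; split.
  apply/integrableP; split; first exact/measurable_EFinP.
  rewrite [ltLHS](@integral_dirac _ _ _ R setT measurableT (abse \o (EFin \o f))).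
    by rewrite diracT mul1e/= ltry.
  by apply: measurableT_comp => //; exact/measurable_EFinP.
rewrite /Rintegral [X in fine X](@integral_dirac _ _ _ R setT measurableT (EFin \o f)).
  by rewrite diracT mul1e.
exact/measurable_EFinP.
Qed.

Lemma Rintegral_rV_succ n (f : 'rV[R]_n.+1 -> R)
    (g1 : measurableTypeR R -> R) (g2 : 'rV[R]_n -> R) :
  measurable_fun setT f ->
  mu.-integrable setT (EFin \o g1) -> (lebesgue_rV n).-integrable setT (EFin \o g2) ->
  (forall x v, `|f (cons_rV (x, v))| <= g1 x * g2 v) ->
  (lebesgue_rV n.+1).-integrable setT (EFin \o f) /\
  \int[lebesgue_rV n.+1]_x f x = \int[mu]_x \int[lebesgue_rV n]_v f (cons_rV (x, v)).
Proof.
move=> mf i1 i2 fg.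
have mfc := measurableT_comp mf (@measurable_cons_rV R n).
have ip := integrable_prod_dominated mfc i1 i2 fg.
have mEf : measurable_fun setT (EFin \o f) by exact/measurable_EFinP.
split.
  exact: (integrable_pushforward (@measurable_cons_rV R n) mEf).
rewrite -(Rintegral_prod_dominated mfc i1 i2 fg) /Rintegral; congr fine.
by rewrite [LHS](integral_pushforward (@measurable_cons_rV R n) mEf)// preimage_setT.
Qed.

Lemma integrable_prod_coord n (p : 'I_n -> R -> R) :
  (forall i, mu.-integrable setT (EFin \o p i)) ->
  (lebesgue_rV n).-integrable setT (EFin \o (fun x : 'rV[R]_n => \prod_i p i (x ord0 i))).
Proof.
elim: n p => [|n IH] p ip.
  by apply: (Rintegral_rV0 _).1; apply: measurable_prod_coord => -[].
have ip' := IH _ (fun i => integrable_norm (ip (lift ord0 i))).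
apply: (Rintegral_rV_succ _ (integrable_norm (ip ord0)) ip' _).1.
  by apply: measurable_prod_coord => i; exact: (integrable_measurable measurableT (ip i)).
move=> x v /=; rewrite big_ord_recl cons_rV0 normrM normr_prod.
by under eq_bigr do rewrite cons_rVS.
Qed.

(** The integral of a product of one-variable functions against a complex
    exponential of a sum of one-variable phases is the product of the
    one-variable integrals.  The two parts are proved together because the addition
    formulas mix them. *)
Lemma Rintegral_prod_trig n (p phi : 'I_n -> R -> R) (A theta : 'I_n -> R) :
  (forall i, mu.-integrable setT (EFin \o p i)) ->
  (forall i, measurable_fun setT (phi i)) ->
  (forall i, \int[mu]_y (p i y * cos (phi i y)) = A i * cos (theta i)) ->
  (forall i, \int[mu]_y (p i y * sin (phi i y)) = A i * sin (theta i)) ->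
  \int[lebesgue_rV n]_x ((\prod_i p i (x ord0 i)) * cos (\sum_i phi i (x ord0 i)))
    = (\prod_i A i) * cos (\sum_i theta i) /\
  \int[lebesgue_rV n]_x ((\prod_i p i (x ord0 i)) * sin (\sum_i phi i (x ord0 i)))
    = (\prod_i A i) * sin (\sum_i theta i).
Proof.
elim: n p phi A theta => [|n IH] p phi A theta ip mphi pc ps.
  have mp : measurable_fun setT (fun x : 'rV[R]_0 => \prod_i p i (x ord0 i)).
    by apply: measurable_prod_coord => -[].
  have ms : measurable_fun setT (fun x : 'rV[R]_0 => \sum_i phi i (x ord0 i)).
    by apply: measurable_sum_coord => -[].
  split; rewrite (Rintegral_rV0 _).2 ?big_ord0//; apply: measurable_funM => //.
  - exact: (measurableT_comp measurable_cos).
  - exact: (measurableT_comp measurable_sin).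
have mp : measurable_fun setT (fun x : 'rV[R]_n.+1 => \prod_i p i (x ord0 i)).
  by apply: measurable_prod_coord => i; exact: (integrable_measurable measurableT (ip i)).
have ms : measurable_fun setT (fun x : 'rV[R]_n.+1 => \sum_i phi i (x ord0 i)).
  exact: measurable_sum_coord.
pose P (v : 'rV[R]_n) := \prod_i p (lift ord0 i) (v ord0 i).
pose S (v : 'rV[R]_n) := \sum_i phi (lift ord0 i) (v ord0 i).
have iP : (lebesgue_rV n).-integrable setT (EFin \o P).
  exact: (@integrable_prod_coord n (fun i => p (lift ord0 i)) (fun i => ip _)).
have mS : measurable_fun setT S.
  exact: (@measurable_sum_coord n (fun i => phi (lift ord0 i)) (fun i => mphi _)).
have [IHc IHs] := IH (fun i => p (lift ord0 i)) (fun i => phi (lift ord0 i))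
  (fun i => A (lift ord0 i)) (fun i => theta (lift ord0 i))
  (fun i => ip _) (fun i => mphi _) (fun i => pc _) (fun i => ps _).
set B := \prod_i A (lift ord0 i) in IHc IHs.
set th := \sum_i theta (lift ord0 i) in IHc IHs.
have iPg (g : R -> R) : measurable_fun setT g -> (forall y, `|g y| <= 1) ->
    (lebesgue_rV n).-integrable setT (EFin \o (fun v => P v * g (S v))).
  move=> mg g1; apply: integrable_mul_bounded => //.
  exact: (measurableT_comp mg).
have ipg i (g : R -> R) : measurable_fun setT g -> (forall y, `|g y| <= 1) ->
    mu.-integrable setT (EFin \o (fun y => p i y * g (phi i y))).
  move=> mg g1; apply: integrable_mul_bounded => //.
  exact: (measurableT_comp mg (mphi i)).
have step (g : R -> R) : measurable_fun setT g -> (forall y, `|g y| <= 1) ->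
    \int[lebesgue_rV n.+1]_x ((\prod_i p i (x ord0 i)) * g (\sum_i phi i (x ord0 i))) =
    \int[mu]_y \int[lebesgue_rV n]_v (p ord0 y * P v * g (phi ord0 y + S v)).
  move=> mg g1.
  rewrite (Rintegral_rV_succ (g1 := fun y => `|p ord0 y|) (g2 := fun v => `|P v|) _ _ _ _).2.
  - apply: eq_Rintegral => y _; apply: eq_Rintegral => v _.
    rewrite !big_ord_recl cons_rV0; congr (_ * _ * g (_ + _)).
      by apply: eq_bigr => i _; rewrite cons_rVS.
    by apply: eq_bigr => i _; rewrite cons_rVS.
  - by apply: measurable_funM => //; exact: (measurableT_comp mg).
  - exact: integrable_norm.
  - exact: integrable_norm.
  - move=> y v; rewrite normrM big_ord_recl cons_rV0 normrM.
    under eq_bigr do rewrite cons_rVS.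
    by rewrite ler_piMr// mulr_ge0.
have iPc := iPg cos measurable_cos (@cos_max R).
have iPs := iPg sin measurable_sin (@sin_max R).
have ipc := ipg ord0 cos measurable_cos (@cos_max R).
have ips := ipg ord0 sin measurable_sin (@sin_max R).
rewrite (step cos measurable_cos (@cos_max R)) (step sin measurable_sin (@sin_max R)).
have inner_cos y : \int[lebesgue_rV n]_v (p ord0 y * P v * cos (phi ord0 y + S v)) =
    B * cos th * (p ord0 y * cos (phi ord0 y)) - B * sin th * (p ord0 y * sin (phi ord0 y)).
  under eq_Rintegral => v _.
    rewrite (_ : _ * _ = p ord0 y * cos (phi ord0 y) * (P v * cos (S v)) -
      p ord0 y * sin (phi ord0 y) * (P v * sin (S v))); last by rewrite cosD; ring.
    over.
  rewrite RintegralB//; try exact: EFin_integrableZl.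
  by rewrite !RintegralZl// IHc IHs; ring.
have inner_sin y : \int[lebesgue_rV n]_v (p ord0 y * P v * sin (phi ord0 y + S v)) =
    B * cos th * (p ord0 y * sin (phi ord0 y)) + B * sin th * (p ord0 y * cos (phi ord0 y)).
  under eq_Rintegral => v _.
    rewrite (_ : _ * _ = p ord0 y * sin (phi ord0 y) * (P v * cos (S v)) +
      p ord0 y * cos (phi ord0 y) * (P v * sin (S v))); last by rewrite sinD; ring.
    over.
  rewrite RintegralD//; try exact: EFin_integrableZl.
  by rewrite !RintegralZl// IHc IHs; ring.
rewrite !big_ord_recl -/B -/th cosD sinD; split.
- under eq_Rintegral do rewrite inner_cos.
  rewrite RintegralB//; try exact: EFin_integrableZl.
  by rewrite !RintegralZl// pc ps; ring.
- under eq_Rintegral do rewrite inner_sin.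
  rewrite RintegralD//; try exact: EFin_integrableZl.
  by rewrite !RintegralZl// pc ps; ring.
Qed.

End ProductIntegral.

(** * Euclidean norm, cubes and boundary *)

Section Space.
Context {R : realType} {d : nat}.
Implicit Types (x y z b : 'rV[R]_d) (A Omega : set 'rV[R]_d).

Lemma enorm_ge0 x : 0 <= enorm x.
Proof. exact: sqrtr_ge0. Qed.

Lemma enorm_sqr x : enorm x ^+ 2 = \sum_i x ord0 i ^+ 2.
Proof.
rewrite /enorm sqr_sqrtr; first by apply: eq_bigr => i _; rewrite expr2.
by apply: sumr_ge0 => i _; rewrite -expr2 sqr_ge0.
Qed.

Lemma coord_le_enorm x i : `|x ord0 i| <= enorm x.
Proof.
rewrite -(@ler_pXn2r _ 2)// ?nnegrE ?enorm_ge0// enorm_sqr real_normK ?num_real//.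
by rewrite (bigD1 i)//= lerDl sumr_ge0// => j _; exact: sqr_ge0.
Qed.

Lemma enorm_le x (e : R) : 0 <= e -> (forall i, `|x ord0 i| <= e) -> enorm x <= d%:R * e.
Proof.
move=> e0 xe; rewrite -(@ler_pXn2r _ 2)// ?nnegrE ?enorm_ge0 ?mulr_ge0//.
rewrite enorm_sqr (le_trans (_ : _ <= \sum_(i < d) e ^+ 2))//.
  apply: ler_sum => i _; rewrite -(real_normK (num_real (x ord0 i))).
  by rewrite lerXn2r ?nnegrE.
rewrite sumr_const card_ord -[leLHS]mulr_natl exprMn ler_wpM2r ?sqr_ge0//.
by rewrite -natrX ler_nat; case: (d) => // k; rewrite leq_pmull.
Qed.

Lemma enormZ (t : R) x : 0 <= t -> enorm (t *: x) = t * enorm x.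
Proof.
move=> t0; apply/eqP; rewrite -(@eqrXn2 _ 2)// ?enorm_ge0 ?mulr_ge0 ?enorm_ge0//.
rewrite exprMn !enorm_sqr mulr_sumr; apply/eqP; apply: eq_bigr => i _.
by rewrite mxE exprMn.
Qed.

Lemma enormB x y : enorm (x - y) = enorm (y - x).
Proof.
apply/eqP; rewrite -(@eqrXn2 _ 2)// ?enorm_ge0// !enorm_sqr; apply/eqP.
by apply: eq_bigr => i _; rewrite !mxE -sqrrN opprB.
Qed.

Lemma open_box A x : open A -> A x ->
  exists2 e : R, 0 < e & forall y, (forall i, `|y ord0 i - x ord0 i| < e) -> A y.
Proof.
move=> oA Ax; have /nbhs_ballP[e /= e0 sub] : nbhs x A by exact: open_nbhs_nbhs.
exists e => // y ye; apply: sub; split => // i j.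
by rewrite (ord1 i) -ball_normE /= distrC.
Qed.

Lemma measurable_box b (r : R) :
  measurable [set y : 'rV[R]_d | forall i, `|y ord0 i - b ord0 i| < r].
Proof.
rewrite (_ : [set y | _] = \big[setI/setT]_(i < d) ((fun x : 'rV[R]_d => x ord0 i)
  @^-1` [set` `]b ord0 i - r, b ord0 i + r[])).
  apply: bigsetI_measurable => i _; rewrite -[X in measurable X]setTI.
  exact: measurable_coord.
rewrite -bigcap_seq; apply/seteqP; split => x /= H i.
  by move=> _; have := H i; rewrite ltr_distl /= in_itv.
by rewrite ltr_distl; have := H i (mem_index_enum _); rewrite /= in_itv.
Qed.

(** The sigma-algebra is generated by the coordinates, so the point is that an
    open set is a countable union of cubes with rational centre and radius. *)
Lemma open_measurable_rV A : open A -> measurable A.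
Proof.
move=> oA.
pose B (p : {ffun 'I_d -> rat} * rat) : set 'rV[R]_d :=
  [set y | forall i, `|y ord0 i - ratr (p.1 i)| < ratr p.2].
pose F p := if `[< B p `<=` A >] then B p else set0.
have -> : A = \bigcup_p F p.
  apply/seteqP; split => [x Ax|x [p _]]; last by rewrite /F; case: asboolP => // + Bx; exact.
  have [e e0 sub] := open_box oA Ax.
  have [r] : exists r : rat, ratr r \in `](0 : R), e / 2[ by apply: rat_in_itvoo; rewrite divr_gt0.
  rewrite in_itv/= => /andP[r0 re].
  have ex i : exists q : rat, `|x ord0 i - ratr q| < ratr r.
    have [q] : exists q : rat, ratr q \in `](x ord0 i - ratr r), (x ord0 i + ratr r)[.
      by apply: rat_in_itvoo; lra.
    by rewrite in_itv/= => /andP[q1 q2]; exists q; rewrite ltr_norml; apply/andP; split; lra.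
  pose c := [ffun i => projT1 (cid (ex i))].
  have cE i : `|x ord0 i - ratr (c i)| < ratr r by rewrite ffunE; case: cid.
  exists (c, r) => //; rewrite /F; case: asboolP => //; case=> y By; apply: sub => i.
  by move: (By i) (cE i) => /=; rewrite !ltr_norml => /andP[? ?] /andP[? ?]; apply/andP; split; lra.
apply: countable_bigcupT_measurable; first exact: countableP.
move=> p; rewrite /F; case: asboolP => // _.
have := measurable_box (\row_i ratr (p.1 i)) (ratr p.2).
congr (measurable _); apply/seteqP; split => y H i; have := H i; by rewrite mxE.
Qed.

(** Otherwise the parameters [t] of [[0, 1]] mapped into [Omega] coincide with those
    mapped into its closure, and form a nonempty proper subset of [[0, 1]] that is
    both relatively open and relatively closed. *)
Lemma segment_meets_boundary Omega x y : open Omega -> Omega x -> ~ Omega y ->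
  exists2 t : R, 0 <= t <= 1 & boundary Omega (x + t *: (y - x)).
Proof.
move=> oO Ox nOy; apply: contrapT => nb.
pose p (t : R) : 'rV[R]_d := x + t *: (y - x).
have cp : continuous p.
  move=> t; apply: cvgD; first exact: cvg_cst.
  by apply: cvgZr_tmp; exact: cvg_id.
have E : `[0, 1]%classic `&` p @^-1` Omega = `[0, 1]%classic.
  apply: (@segment_connected R 0 1).
  - by exists 0; split; rewrite /= ?in_itv/= ?lexx ?ler01// /p scale0r addr0.
  - by exists (p @^-1` Omega) => //; apply: open_comp => // t _; exact: cp.
  - exists (p @^-1` closure Omega).
      by apply: closed_comp => [t _|]; [exact: cp|exact: closed_closure].
    apply/seteqP; split => t [t01 tO]; split => //; first exact: subset_closure.
    apply: contrapT => ntO; apply: nb; exists t; first by move: t01; rewrite /= in_itv.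
    by split => // /interior_subset.
have : (`[0, 1]%classic `&` p @^-1` Omega) 1.
  by rewrite E/= in_itv/= lexx ler01.
by case=> _; rewrite /= /p scale1r addrC subrK.
Qed.

End Space.

(** * Multivariate tents and powers of sinc *)

Section Multivariate.
Context {R : realType}.
Local Notation mu := (@lebesgue_measure R).

(** Up to a constant, and for suitable even [k], a minorant of [Phihat] times the
    symbol of a tent; for [k >= 2] its transform is supported in the cube of half-side [k s]. *)
Definition sinc_pow_rV n (k : nat) (s : R) (w : 'rV[R]_n) : R :=
  \prod_i sinc (s * w ord0 i) ^+ k.

Definition tent_rV n (s : R) (b y : 'rV[R]_n) : R :=
  \prod_i tent ((y ord0 i - b ord0 i) / s).

(** The Fourier symbol of [tent_rV s b] up to the phase of the centre [b]. *)
Definition tent_hat_rV n (s : R) (w : 'rV[R]_n) : R :=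
  \prod_i (s * tent_hat (s * w ord0 i)).

Let sinc_scale k s z : 0 < s ->
  [/\ mu.-integrable setT (EFin \o (fun u => sinc (s * u) ^+ k.+2)),
    \int[mu]_u (sinc (s * u) ^+ k.+2 * cos (u * z)) =
      s^-1 * \int[mu]_u (sinc u ^+ k.+2 * cos (z / s * u)) &
    \int[mu]_u (sinc (s * u) ^+ k.+2 * sin (u * z)) = 0].
Proof.
move=> s0; have sn0 : s != 0 by rewrite gt_eqF.
split.
- have := integrable_affine 0 sn0 (@integrable_sinc_pow R k).
  by apply: eq_integrable => // u _; rewrite /= addr0.
- rewrite (Rintegral_affine 0 sn0 (@integrable_sinc_cos R k (z / s))).
  rewrite gtr0_norm// mulKf//; apply: eq_Rintegral => u _; rewrite addr0.
  by congr (_ * cos _); field.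
- apply: (mulfI sn0); rewrite mulr0 -[RHS](@Rintegral_sinc_sin R k (z / s)).
  rewrite (Rintegral_affine 0 sn0 (@integrable_sinc_sin R k (z / s))) gtr0_norm//.
  congr (_ * _); apply: eq_Rintegral => u _; rewrite addr0.
  by congr (_ * sin _); field.
Qed.

Lemma Rintegral_sinc_pow_rV n k s (z : 'rV[R]_n) : 0 < s ->
  \int[lebesgue_rV n]_w (sinc_pow_rV k.+2 s w * cos (dotr w z)) =
  \prod_i (s^-1 * \int[mu]_u (sinc u ^+ k.+2 * cos (z ord0 i / s * u))).
Proof.
move=> s0.
have [] := @Rintegral_prod_trig R n (fun _ u => sinc (s * u) ^+ k.+2)
  (fun i u => u * z ord0 i)
  (fun i => s^-1 * \int[mu]_u (sinc u ^+ k.+2 * cos (z ord0 i / s * u))) (fun=> 0).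
- by move=> i; have [] := sinc_scale k 0 s0.
- by move=> i; exact: measurable_funM.
- by move=> i; have [_ -> _] := sinc_scale k (z ord0 i) s0; rewrite cos0 mulr1.
- by move=> i; have [_ _ ->] := sinc_scale k (z ord0 i) s0; rewrite sin0 mulr0.
by move=> + _; rewrite sumr_const mul0rn cos0 mulr1.
Qed.

Lemma integrable_sinc_pow_rV n k s : 0 < s ->
  (lebesgue_rV n).-integrable setT (EFin \o sinc_pow_rV (n := n) k.+2 s).
Proof.
move=> s0; apply: (@integrable_prod_coord R n (fun _ u => sinc (s * u) ^+ k.+2)) => i.
by have [] := sinc_scale k 0 s0.
Qed.

(** One large coordinate of [z] suffices, because the integral is a product over the
    coordinates. *)
Lemma Rintegral_sinc_pow_rV_eq0 n k s (z : 'rV[R]_n) i : 0 < s ->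
  k.+2%:R * s <= `|z ord0 i| ->
  \int[lebesgue_rV n]_w (sinc_pow_rV k.+2 s w * cos (dotr w z)) = 0.
Proof.
move=> s0 zi; rewrite Rintegral_sinc_pow_rV// (bigD1 i)//= Rintegral_sinc_cos_eq0.
  by rewrite mulr0 mul0r.
by rewrite normrM normfV (gtr0_norm s0) ler_pdivlMr.
Qed.

Lemma Rintegral_sinc_pow_rV_mass n k s : 0 < s ->
  \int[lebesgue_rV n]_w (sinc_pow_rV k.+2 s w) =
  (s^-1 * \int[mu]_u (sinc u ^+ k.+2)) ^+ n.
Proof.
move=> s0; transitivity (\int[lebesgue_rV n]_w (sinc_pow_rV k.+2 s w * cos (dotr w 0))).
  apply: eq_Rintegral => w _; rewrite /dotr big1 ?cos0 ?mulr1// => i _.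
  by rewrite mxE mulr0.
rewrite Rintegral_sinc_pow_rV// (eq_bigr (fun=> s^-1 * \int[mu]_u (sinc u ^+ k.+2))).
  by rewrite prodr_const card_ord.
move=> i _; congr (_ * _); apply: eq_Rintegral => u _.
by rewrite mxE mul0r mul0r cos0 mulr1.
Qed.

Let integrable_tent_scale (s b : R) : 0 < s ->
  mu.-integrable setT (EFin \o (fun y => tent ((y - b) / s))).
Proof.
move=> s0; have sV0 : s^-1 != 0 by rewrite invr_neq0// gt_eqF.
have it : mu.-integrable setT (EFin \o (@tent R)).
  have := @integrable_tent_cos R 0.
  by apply: eq_integrable => // y _; rewrite /= mul0r cos0 mulr1.
have := integrable_affine (- (b / s)) sV0 it.
apply: eq_integrable => // y _; rewrite /=; congr (EFin (tent _)); ring.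
Qed.

Lemma integrable_tent_rV n s (b : 'rV[R]_n) : 0 < s ->
  (lebesgue_rV n).-integrable setT (EFin \o tent_rV s b).
Proof.
move=> s0; apply: (@integrable_prod_coord R n (fun i y => tent ((y - b ord0 i) / s))) => i.
exact: integrable_tent_scale.
Qed.

Lemma Rintegral_tent_rV n s (a b w : 'rV[R]_n) : 0 < s ->
  \int[lebesgue_rV n]_y (tent_rV s b y * cos (dotr w (a - y))) =
  tent_hat_rV s w * cos (dotr w (a - b)).
Proof.
move=> s0.
have [] := @Rintegral_prod_trig R n (fun i y => tent ((y - b ord0 i) / s))
  (fun i y => w ord0 i * (a ord0 i - y))
  (fun i => s * tent_hat (s * w ord0 i)) (fun i => w ord0 i * (a ord0 i - b ord0 i)).
- by move=> i; exact: integrable_tent_scale.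
- by move=> i; apply: measurable_funM => //; exact: measurable_funB.
- by move=> i; have [] := Rintegral_tent_shift (a ord0 i) (b ord0 i) (w ord0 i) s0.
- by move=> i; have [] := Rintegral_tent_shift (a ord0 i) (b ord0 i) (w ord0 i) s0.
move=> E _; rewrite /dotr.
under [in RHS]eq_bigr do rewrite !mxE.
rewrite -[RHS]E; apply: eq_Rintegral => y _; congr (_ * cos _).
by apply: eq_bigr => i _; rewrite !mxE.
Qed.

Lemma tent_rV_ge0 n s (b y : 'rV[R]_n) : 0 <= tent_rV s b y.
Proof. by apply: prodr_ge0 => i _; exact: tent_ge0. Qed.

Lemma tent_rV_le1 n s (b y : 'rV[R]_n) : tent_rV s b y <= 1.
Proof. by apply: prodr_ile1 => i _; rewrite tent_ge0 tent_le1. Qed.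

Lemma tent_rV_eq0 n s (b y : 'rV[R]_n) i : 0 < s -> s <= `|y ord0 i - b ord0 i| ->
  tent_rV s b y = 0.
Proof.
move=> s0 yi; rewrite /tent_rV (bigD1 i)//= tent_eq0 ?mul0r//.
by rewrite normrM normfV (gtr0_norm s0) ler_pdivlMr// mul1r.
Qed.

Lemma sinc_pow_le m (tau u : R) : 0 < tau -> tau <= m%:R ->
  sinc u ^+ (2 * m) <= 2 ^+ m * (1 + u ^+ 2) `^ (- tau).
Proof.
move=> tau0 taum; have p : 1 <= 1 + u ^+ 2 by rewrite lerDl sqr_ge0.
have p0 : 0 < 1 + u ^+ 2 by rewrite (lt_le_trans _ p).
rewrite exprM (le_trans (_ : _ <= (2 / (1 + u ^+ 2)) ^+ m))//.
  by rewrite lerXn2r ?nnegrE ?sqr_ge0 ?divr_ge0 ?(ltW p0)// sinc_sqr_le.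
rewrite exprMn exprVn ler_wpM2l ?exprn_ge0//.
rewrite -(powR_mulrn m (ltW p0)) powRN lef_pV2 ?posrE ?powR_gt0//.
exact: ler_powR.
Qed.

Lemma powR_prod n (x : 'I_n -> R) (r : R) : (forall i, 0 <= x i) ->
  (\prod_i x i) `^ r = \prod_i x i `^ r.
Proof.
move=> x0; elim: n x x0 => [|n IH] x x0; first by rewrite !big_ord0 powR1.
by rewrite !big_ord_recl powRM ?IH// prodr_ge0.
Qed.

Lemma powRN_le (x y r : R) : 0 <= r -> 0 < x -> x <= y -> y `^ (- r) <= x `^ (- r).
Proof.
move=> r0 x0 xy; have y0 := lt_le_trans x0 xy.
by rewrite !powRN lef_pV2 ?posrE ?powR_gt0// ge0_ler_powR// nnegrE ltW.
Qed.

Lemma prodr_oneD_ge n (x : 'I_n -> R) : (forall i, 0 <= x i) ->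
  1 + \sum_i x i <= \prod_i (1 + x i).
Proof.
elim: n x => [|n IH] x x0; first by rewrite !big_ord0 addr0.
rewrite !big_ord_recl; have := IH _ (fun i => x0 (lift ord0 i)).
have := x0 ord0; have : 0 <= \sum_(i < n) x (lift ord0 i) by exact: sumr_ge0.
set A := \sum_(_ < _) _; set B := \prod_(_ < _) _; nra.
Qed.

(** Coordinatewise, [sinc(s w_i)^(2m)] is at most [2^m (1 + s^2 w_i^2)^(-tau)], and
    the product of the factors [1 + s^2 w_i^2] is at least [1 + s^2 |w|^2].  The
    bound [s <= s0] makes the comparison with [1 + |w|^2] uniform: the latter
    costs a factor [(s / s0)^2] and no more. *)
Lemma sinc_pow_rV_le n m (tau s s0 : R) (w : 'rV[R]_n) :
  0 < tau -> tau <= m%:R -> 0 < s -> s <= s0 -> 1 <= s0 ->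
  (s / s0) `^ (2 * tau) * sinc_pow_rV (2 * m) s w <=
    2 ^+ (m * n) * (1 + enorm w ^+ 2) `^ (- tau).
Proof.
move=> tau0 taum sp ss0 s01.
pose P := \prod_(i < n) (1 + (s * w ord0 i) ^+ 2).
have Pge : 1 + s ^+ 2 * enorm w ^+ 2 <= P.
  rewrite enorm_sqr mulr_sumr; under eq_bigr do rewrite -exprMn.
  by apply: (@prodr_oneD_ge n (fun i => (s * w ord0 i) ^+ 2)) => i; exact: sqr_ge0.
have e0 : 0 <= enorm w ^+ 2 by exact: sqr_ge0.
have P0 : 0 < P by rewrite (lt_le_trans _ Pge)// ltr_pwDl// mulr_ge0// sqr_ge0.
have step1 : sinc_pow_rV (2 * m) s w <= 2 ^+ (m * n) * P `^ (- tau).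
  rewrite (_ : _ * _ = \prod_(i < n) (2 ^+ m * (1 + (s * w ord0 i) ^+ 2) `^ (- tau))).
    apply: ler_prod => i _; rewrite sinc_pow_le// andbT.
    by rewrite exprM exprn_ge0// sqr_ge0.
  rewrite big_split/= prodr_const card_ord -exprM; congr (_ * _).
  by rewrite powR_prod// => i; rewrite addr_ge0// sqr_ge0.
set t := (s / s0) ^+ 2.
have s00 : 0 < s0 by rewrite (lt_le_trans _ s01).
have t0 : 0 < t by rewrite exprn_gt0// divr_gt0.
have t1 : t <= 1.
  by rewrite expr_le1// ?ler_pdivrMr ?mul1r// divr_ge0// ltW.
have ts : t <= s ^+ 2.
  by rewrite /t exprMn ler_piMr ?sqr_ge0// exprVn invf_le1 ?exprn_gt0// expr_ge1// ltW.
have tP : t * (1 + enorm w ^+ 2) <= P.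
  apply: le_trans Pge; rewrite mulrDr mulr1 lerD// ler_wpM2r//.
have -> : (s / s0) `^ (2 * tau) = t `^ tau.
  by rewrite powRrM -[2]/(2%:R) powR_mulrn// divr_ge0// ltW.
apply: le_trans (ler_wpM2l (powR_ge0 _ _) step1) _.
rewrite mulrCA ler_wpM2l ?exprn_ge0//.
have e1 : 0 < 1 + enorm w ^+ 2 by rewrite ltr_pwDl.
apply: le_trans (ler_wpM2l (powR_ge0 _ _) (powRN_le (ltW tau0) _ tP)) _.
  by rewrite mulr_gt0.
rewrite powRM ?(ltW t0) ?(ltW e1)// mulrA -powRD ?subrr ?powRr0 ?mul1r//.
by rewrite (gt_eqF t0) implybT.
Qed.

End Multivariate.

(** * Separation, distance to the boundary and packing *)

Section PointSets.
Context {R : realType} {d : nat}.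
Implicit Types (x y z b : 'rV[R]_d) (A Omega : set 'rV[R]_d).

Lemma bounded_coord Omega : bounded_set Omega ->
  exists2 M : R, 0 < M & forall x, Omega x -> forall i, `|x ord0 i| <= M.
Proof.
move=> [M [_ HM]]; exists (`|M| + 1); first by rewrite ltr_wpDl.
move=> x Ox i; apply: le_trans (HM (`|M| + 1) _ x Ox); last first.
  by rewrite (le_lt_trans (ler_norm M))// ltrDl.
by rewrite [leRHS]mx_normrE; exact: (le_bigmax _ _ (ord0, i)).
Qed.

Lemma measurable_ocbox (a c : 'I_d -> R) :
  measurable [set x : 'rV[R]_d | forall i, x ord0 i \in `]a i, c i]].
Proof.
rewrite (_ : [set y | _] = \big[setI/setT]_(i < d) ((fun x : 'rV[R]_d => x ord0 i)
  @^-1` [set` `]a i, c i]])).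
  apply: bigsetI_measurable => i _; rewrite -[X in measurable X]setTI.
  exact: measurable_coord.
rewrite -bigcap_seq; apply/seteqP; split => x /= H i; first by move=> _; exact: H.
by have := H i (mem_index_enum _).
Qed.

Lemma bounded_finite_measure Omega : open Omega -> bounded_set Omega ->
  (lebesgue_rV d Omega < +oo)%E.
Proof.
move=> oO /bounded_coord[M M0 HM].
apply: (@le_lt_trans _ _ (lebesgue_rV d
    [set x : 'rV[R]_d | forall i, x ord0 i \in `](- (M + 1)), (M + 1)]])).
  apply: le_measure; rewrite ?inE.
  - exact: open_measurable_rV.
  - exact: measurable_ocbox.
  - move=> x Ox i; have := HM x Ox i; rewrite ler_norml in_itv/= => /andP[? ?].
    by apply/andP; split; lra.
rewrite (lebesgue_rV_box (a := fun=> - (M + 1)) (b := fun=> M + 1)) ?ltry//.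
by move=> _; lra.
Qed.

Lemma bounded_boundary_neq0 Omega : (0 < d)%N -> open Omega -> Omega !=set0 ->
  bounded_set Omega -> boundary Omega !=set0.
Proof.
move=> d0 oO [x Ox] /bounded_coord[M M0 HM].
have [|t _ bt] := @segment_meets_boundary R d Omega x (const_mx (M + 1)) oO Ox.
  move=> /HM /(_ (Ordinal d0)); rewrite mxE ger0_norm; last by lra.
  by lra.
by exists (x + t *: (const_mx (M + 1) - x)).
Qed.

Context {n : nat}.
Implicit Types X : 'I_n -> 'rV[R]_d.

Lemma separation_distance_le X i j : X i != X j ->
  2 * separation_distance X <= enorm (X i - X j).
Proof.
move=> Xij; rewrite mulrA divff// mul1r; apply: ge_inf; last by exists i, j.
by exists 0 => _ [k [l [_ ->]]]; exact: enorm_ge0.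
Qed.

Lemma dist_boundary_le X Omega i y : boundary Omega y ->
  dist_boundary X Omega <= enorm (X i - y).
Proof.
move=> by_; apply: ge_inf; last by exists i, y.
by exists 0 => _ [k [z [_ ->]]]; exact: enorm_ge0.
Qed.

(** A point of the cube outside [Omega] would put a boundary point on the segment
    to the centre, closer than the distance to the boundary allows. *)
Lemma box_sub_domain X Omega i y (s : R) : open Omega -> (forall j, Omega (X j)) -> 0 <= s ->
  d%:R * s < dist_boundary X Omega ->
  (forall k, `|y ord0 k - X i ord0 k| <= s) -> Omega y.
Proof.
move=> oO OX s0 sd yX; apply: contrapT => nOy.
have [t /andP[t0 t1] bt] := segment_meets_boundary oO (OX i) nOy.
have := dist_boundary_le X i bt; rewrite leNgt => /negP; apply.
apply: le_lt_trans sd.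
rewrite enormB [X in enorm X](_ : _ = t *: (y - X i)).
  rewrite enormZ// (le_trans (_ : _ <= enorm (y - X i))) ?ler_piMl ?enorm_ge0//.
  by apply: enorm_le => // k; rewrite !mxE.
by rewrite addrC addrA addNr add0r.
Qed.

Lemma finite_pos_lb (I : finType) (f : I -> R) : (forall i, 0 < f i) ->
  exists2 e : R, 0 < e & forall i, e <= f i.
Proof.
move=> f0; exists (\big[Num.min/1]_i f i).
  by apply: (big_ind (fun x : R => 0 < x)) => // x y x0 y0; rewrite lt_min x0.
by move=> i; rewrite (bigD1 i)//= ge_min lexx.
Qed.

Lemma separation_distance_gt0 X : (2 <= n)%N -> injective X ->
  0 < separation_distance X.
Proof.
move=> n2 injX; rewrite /separation_distance mulr_gt0// ?invr_gt0//.
have [e e0 ef] : exists2 e : R, 0 < e & forall p : 'I_n * 'I_n,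
    e <= if X p.1 != X p.2 then enorm (X p.1 - X p.2) else 1.
  apply: finite_pos_lb => -[i j] /=; case: ifPn => // Xij.
  rewrite lt_neqAle enorm_ge0 andbT eq_sym; apply: contraNneq Xij => e0.
  apply/eqP/rowP => k; have := coord_le_enorm (X i - X j) k.
  by rewrite e0 !mxE normr_le0 subr_eq0 => /eqP.
apply: lt_le_trans e0 _; apply: lb_le_inf.
  have n0 : (0 < n)%N by exact: ltnW.
  exists (enorm (X (Ordinal n0) - X (Ordinal n2))), (Ordinal n0), (Ordinal n2); split => //.
  by apply/eqP => /injX.
by move=> _ [i [j [Xij ->]]]; have := ef (i, j); rewrite /= Xij.
Qed.

Lemma dist_boundary_gt0 X Omega : (0 < d)%N -> (0 < n)%N -> open Omega -> bounded_set Omega ->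
  (forall i, Omega (X i)) -> 0 < dist_boundary X Omega.
Proof.
move=> d0 n0 oO bO OX.
have ex i : exists e : R, 0 < e /\
    forall y, (forall k, `|y ord0 k - X i ord0 k| < e) -> Omega y.
  by have [e e0 H] := open_box oO (OX i); exists e.
have [e e0 ef] := finite_pos_lb (fun i => (projT2 (cid (ex i))).1).
apply: lt_le_trans e0 _; apply: lb_le_inf.
  have [|y by_] := bounded_boundary_neq0 d0 oO _ bO; first by exists (X (Ordinal n0)).
  by exists (enorm (X (Ordinal n0) - y)), (Ordinal n0), y.
move=> _ [i [y [by_ ->]]]; apply: le_trans (ef i) _.
case: cid => /= r [r0 H]; rewrite leNgt; apply/negP => yr.
have [_ +] := by_; apply; have := oO; rewrite openE; apply.
apply: H => k; rewrite distrC; apply: le_lt_trans yr.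
by have := coord_le_enorm (X i - y) k; rewrite !mxE.
Qed.

Lemma separation_distance_bounded X (M : R) : (2 <= n)%N -> injective X ->
  (forall i k, `|X i ord0 k| <= M) -> 0 <= M -> separation_distance X <= d%:R * M.
Proof.
move=> n2 injX XM M0; have n0 : (0 < n)%N by exact: ltnW.
have : X (Ordinal n0) != X (Ordinal n2) by apply/eqP => /injX.
move=> /separation_distance_le.
have : enorm (X (Ordinal n0) - X (Ordinal n2)) <= d%:R * (2 * M).
  apply: enorm_le; first by rewrite mulr_ge0.
  move=> k; rewrite !mxE (le_trans (ler_normB _ _))// mulr_natl mulr2n lerD//.
by lra.
Qed.

(** Around the points there are disjoint cubes of side [2 s] contained in [Omega].
    The cubes are half-open because those are the sets of known volume. *)
Lemma packing_bound X Omega (s : R) : open Omega -> (forall i, Omega (X i)) -> 0 < s ->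
  injective X -> d%:R * s < dist_boundary X Omega ->
  d%:R * s < separation_distance X ->
  ((n%:R * (2 * s) ^+ d)%:E <= lebesgue_rV d Omega)%E.
Proof.
move=> oO OX s0 injX sd ss.
pose F i := [set y : 'rV[R]_d | forall k, y ord0 k \in `]X i ord0 k - s, X i ord0 k + s]].
have mF i : measurable (F i) by exact: measurable_ocbox.
have Fs i y : F i y -> forall k, `|y ord0 k - X i ord0 k| <= s.
  by move=> Fy k; have := Fy k; rewrite in_itv/= ler_distl => /andP[/ltW -> ->].
have tF : trivIset setT F.
  apply/trivIsetP => i j _ _ ij; apply/seteqP; split => // y [/Fs Fi /Fs Fj].
  have Xij : X i != X j by apply: contraNneq ij => /injX ->.
  have := separation_distance_le Xij.
  have : enorm (X i - X j) <= d%:R * (2 * s).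
    apply: enorm_le; first by rewrite mulr_ge0// ltW.
    move=> k; rewrite !mxE; have := Fi k; have := Fj k.
    by rewrite !ler_norml => /andP[? ?] /andP[? ?]; apply/andP; split; lra.
  by lra.
have mFi i : lebesgue_rV d (F i) = ((2 * s) ^+ d)%:E.
  rewrite (lebesgue_rV_box (a := fun k => X i ord0 k - s) (b := fun k => X i ord0 k + s)).
    congr EFin; rewrite (eq_bigr (fun=> 2 * s)); first by rewrite prodr_const card_ord.
    by move=> k _; ring.
  by move=> k; lra.
have := @measure_bigsetU_ord _ _ _ (lebesgue_rV d) n xpredT F mF tF.
rewrite (eq_bigr (fun=> ((2 * s) ^+ d)%:E)); last by move=> i _; exact: mFi.
rewrite sumEFin sumr_const card_ord -[X in X%:E]mulr_natl => <-.
apply: le_measure; rewrite ?inE.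
- by apply: bigsetU_measurable => i _; exact: mF.
- exact: open_measurable_rV.
- rewrite -bigcup_seq => y [i _ /Fs Fy].
  by apply: (box_sub_domain (i := i) oO OX (ltW s0) sd).
Qed.

End PointSets.

(** * Fourier representation of the kernel *)

Section Quadratic.
Context {R : realType}.

(** The double sum is the square of the modulus of a trigonometric sum, hence
    nonnegative. *)
Lemma sum_cosB n (v t : 'I_n -> R) :
  \sum_i \sum_j v i * v j * cos (t i - t j) =
  (\sum_i v i * cos (t i)) ^+ 2 + (\sum_i v i * sin (t i)) ^+ 2.
Proof.
rewrite !expr2 !mulr_suml -big_split; apply: eq_bigr => i _ /=.
rewrite !mulr_sumr -big_split; apply: eq_bigr => j _ /=.
by rewrite cosB; ring.
Qed.

Lemma sqr_sum_le n (a : 'I_n -> R) : (\sum_i a i) ^+ 2 <= n%:R * \sum_i a i ^+ 2.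
Proof.
rewrite expr2 mulr_suml; under eq_bigr do rewrite mulr_sumr.
apply: (@le_trans _ _ (\sum_(i < n) \sum_(j < n) (a i ^+ 2 + a j ^+ 2) / 2)).
  apply: ler_sum => i _; apply: ler_sum => j _.
  by have := sqr_ge0 (a i - a j); rewrite sqrrB; lra.
set S := \sum_(i < n) a i ^+ 2.
rewrite (eq_bigr (fun i => n%:R / 2 * a i ^+ 2 + S / 2)).
  by rewrite big_split/= sumr_const card_ord -mulr_sumr -/S -[S / 2 *+ n]mulr_natl; lra.
move=> i _; rewrite -mulr_suml big_split/= sumr_const card_ord -[a i ^+ 2 *+ n]mulr_natl.
by rewrite -/S; field.
Qed.

End Quadratic.

Section FourierKernel.
Context {R : realType} {d : nat}.
Local Notation leb := (@lebesgue_rV R d).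
Implicit Types (x y z w a b : 'rV[R]_d).

Lemma dotr_subr w a b : dotr w (a - b) = dotr w a - dotr w b.
Proof.
rewrite /dotr -sumrB; apply: eq_bigr => i _.
by rewrite !mxE mulrBr.
Qed.

Lemma measurable_dotr (d' : measure_display) (T' : measurableType d')
    (f g : T' -> 'rV[R]_d) : measurable_fun setT f -> measurable_fun setT g ->
  measurable_fun setT (fun t => dotr (f t) (g t)).
Proof.
move=> mf mg; apply: measurable_sum => i; apply: measurable_funM.
- exact: (measurableT_comp (measurable_coord i) mf).
- exact: (measurableT_comp (measurable_coord i) mg).
Qed.

Variables Phi Phihat : 'rV[R]_d -> R.
Hypothesis PhiF : is_fourier_transform Phi Phihat.
Hypothesis Phihat_ge0 : forall w, 0 <= Phihat w.

Let kappa : R := (2 * pi) `^ (- (d%:R / 2)).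

Let iPhihat : leb.-integrable setT (EFin \o Phihat).
Proof. exact: PhiF.1. Qed.

Lemma fourier_cos x : Phi x = kappa * \int[leb]_w (Phihat w * cos (dotr w x)).
Proof.
have := PhiF.2 x; rewrite /complex_integral -/kappa.
move=> /(congr1 (@complex.Re R)) /=; rewrite mul0r subr0 => ->; congr (_ * _).
by apply: eq_Rintegral => w _ /=; rewrite mul0r subr0.
Qed.

Let measurable_cos_dotr x : measurable_fun setT (fun w => cos (dotr w x)).
Proof.
apply: (measurableT_comp measurable_cos).
by apply: measurable_dotr => //; exact: measurable_cst.
Qed.

Lemma integrable_fourier_cos x :
  leb.-integrable setT (EFin \o (fun w => Phihat w * cos (dotr w x))).
Proof.
apply: (integrable_mul_bounded measurableT iPhihat (measurable_cos_dotr x)) => w _.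
exact: cos_max.
Qed.

Lemma fourier_bound x : `|Phi x| <= kappa * \int[leb]_w Phihat w.
Proof.
rewrite fourier_cos normrM ger0_norm ?powR_ge0// ler_wpM2l ?powR_ge0//.
apply: le_trans (le_normr_Rintegral _ _) _ => //; first exact: integrable_fourier_cos.
apply: le_Rintegral => //; first exact/integrable_norm/integrable_fourier_cos.
by move=> w _; rewrite normrM (ger0_norm (Phihat_ge0 _)) ler_piMr// cos_max.
Qed.

(** Adding 1 to the cosine makes the integrand nonnegative, so that Tonelli gives the
    measurability of the integral in the parameter. *)
Lemma measurable_fourier : measurable_fun setT Phi.
Proof.
have mP := integrable_measurable measurableT iPhihat.
pose F (p : 'rV[R]_d * 'rV[R]_d) : \bar R := (Phihat p.2 * (1 + cos (dotr p.2 p.1)))%:E.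
have mF : measurable_fun setT F.
  apply/measurable_EFinP; apply: measurable_funM.
    exact: (measurableT_comp mP measurable_snd).
  apply: measurable_funD => //; apply: (measurableT_comp measurable_cos).
  by apply: measurable_dotr; [exact: measurable_snd|exact: measurable_fst].
have F0 p : (0 <= F p)%E.
  by rewrite lee_fin mulr_ge0//; have := cos_geN1 (dotr p.2 p.1); lra.
have mI := measurable_fun_fubini_tonelli_F (m2 := leb) F mF F0.
have E : Phi = (fun x => kappa * (fine (\int[leb]_w F (x, w))%E - \int[leb]_w Phihat w)).
  apply/funext => x; rewrite fourier_cos; congr (_ * _).
  rewrite -[fine _]/(\int[leb]_w (Phihat w * (1 + cos (dotr w x)))).
  under [X in _ = X - _]eq_Rintegral do rewrite mulrDr mulr1.
  rewrite RintegralD//; last exact: integrable_fourier_cos.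
  by rewrite addrC addKr.
rewrite E; apply: measurable_funM => //; apply: measurable_funB => //.
exact: (measurableT_comp (fine_measurable _) mI).
Qed.

(** By Fubini, pairing a translate of [Phi] with a tent amounts to multiplying the
    Fourier symbols. *)
Lemma fourier_tent_pairing s a b : 0 < s ->
  \int[leb]_y (tent_rV s b y * Phi (a - y)) =
  kappa * \int[leb]_w (Phihat w * tent_hat_rV s w * cos (dotr w (a - b))).
Proof.
move=> s0.
have mP := integrable_measurable measurableT iPhihat.
have iT := integrable_tent_rV b s0.
have mT := integrable_measurable measurableT iT.
pose f (p : 'rV[R]_d * 'rV[R]_d) : R :=
  tent_rV s b p.1 * (Phihat p.2 * cos (dotr p.2 (a - p.1))).
have mf : measurable_fun setT f.
  apply: measurable_funM; first exact: (measurableT_comp mT measurable_fst).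
  apply: measurable_funM; first exact: (measurableT_comp mP measurable_snd).
  apply: (measurableT_comp measurable_cos).
  under eq_fun do rewrite dotr_subr.
  apply: measurable_funB; exact: measurable_dotr.
have fg y w : `|f (y, w)| <= tent_rV s b y * Phihat w.
  rewrite /f /= normrM ger0_norm ?tent_rV_ge0// ler_wpM2l ?tent_rV_ge0//.
  by rewrite normrM (ger0_norm (Phihat_ge0 _)) ler_piMr// cos_max.
have Fub := Fubini_dominated mf iT iPhihat fg.
transitivity (kappa * \int[leb]_y \int[leb]_w f (y, w)).
  rewrite -(RintegralZl kappa measurableT (integrable_dominated_int1 mf iT iPhihat fg)).
  apply: eq_Rintegral => y _; rewrite fourier_cos mulrCA; congr (_ * _).
  by rewrite -(RintegralZl _ measurableT (integrable_fourier_cos (a - y))).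
rewrite Fub; congr (_ * _); apply: eq_Rintegral => w _.
have iTc : leb.-integrable setT (EFin \o (fun y => tent_rV s b y * cos (dotr w (a - y)))).
  apply: (integrable_mul_bounded measurableT iT); last by move=> y _; exact: cos_max.
  apply: (measurableT_comp measurable_cos); under eq_fun do rewrite dotr_subr.
  apply: measurable_funB; first exact: measurable_cst.
  by apply: measurable_dotr; [exact: measurable_cst|exact: measurable_id].
rewrite -mulrA -(Rintegral_tent_rV a b w s0) -(RintegralZl _ measurableT iTc).
by apply: eq_Rintegral => y _; rewrite /f/=; ring.
Qed.

(** The product is the partial integral in [y] of an integrable function of
    [(w, y)], which gives its measurability too. *)
Lemma integrable_fourier_tent s : 0 < s ->
  leb.-integrable setT (EFin \o (fun w => Phihat w * tent_hat_rV s w)).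
Proof.
move=> s0.
have mP := integrable_measurable measurableT iPhihat.
have iT := integrable_tent_rV (0 : 'rV[R]_d) s0.
have mT := integrable_measurable measurableT iT.
pose f (p : 'rV[R]_d * 'rV[R]_d) : R :=
  Phihat p.1 * (tent_rV s 0 p.2 * cos (dotr p.1 (0 - p.2))).
have mf : measurable_fun setT f.
  apply: measurable_funM; first exact: (measurableT_comp mP measurable_fst).
  apply: measurable_funM; first exact: (measurableT_comp mT measurable_snd).
  apply: (measurableT_comp measurable_cos).
  under eq_fun do rewrite dotr_subr.
  apply: measurable_funB.
    by apply: measurable_dotr; [exact: measurable_fst|exact: measurable_cst].
  by apply: measurable_dotr; [exact: measurable_fst|exact: measurable_snd].
have fg w y : `|f (w, y)| <= Phihat w * tent_rV s 0 y.
  rewrite /f /= normrM (ger0_norm (Phihat_ge0 _)) ler_wpM2l//.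
  by rewrite normrM (ger0_norm (tent_rV_ge0 _ _ _)) ler_piMr ?tent_rV_ge0// cos_max.
have := integrable_dominated_int1 mf iPhihat iT fg.
apply: eq_integrable => // w _ /=; congr EFin.
have iTc : leb.-integrable setT (EFin \o (fun y => tent_rV s 0 y * cos (dotr w (0 - y)))).
  apply: (integrable_mul_bounded measurableT iT); last by move=> y _; exact: cos_max.
  apply: (measurableT_comp measurable_cos); under eq_fun do rewrite dotr_subr.
  apply: measurable_funB; first exact: measurable_cst.
  by apply: measurable_dotr; [exact: measurable_cst|exact: measurable_id].
rewrite /f /= (RintegralZl _ measurableT iTc) (Rintegral_tent_rV 0 0 w s0).
by rewrite dotr_subr subrr cos0 mulr1.
Qed.

End FourierKernel.

(** * Lower bound for the pairing of translates with bumps *)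

Section LowerBound.
Context {R : realType} {d : nat}.
Local Notation leb := (@lebesgue_rV R d).
Local Notation mu := (@lebesgue_measure R).
Implicit Types (x y z w a b : 'rV[R]_d).
Variables Phi Phihat : 'rV[R]_d -> R.
Hypothesis PhiF : is_fourier_transform Phi Phihat.
Variables tau c : R.
Hypotheses (tau_gt0 : 0 < tau) (c_gt0 : 0 < c).
Hypothesis Phihat_ge : forall w, c * (1 + enorm w ^+ 2) `^ (- tau) <= Phihat w.

Let Phihat_ge0 w : 0 <= Phihat w.
Proof. by apply: le_trans (Phihat_ge w); rewrite mulr_ge0 ?powR_ge0// ltW. Qed.

Variable m : nat.
Hypothesis tau_le : tau <= m%:R.

Let kappa : R := (2 * pi) `^ (- (d%:R / 2)).
Let kappa_gt0 : 0 < kappa.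
Proof. by rewrite powR_gt0// mulr_gt0// pi_gt0. Qed.

(** The value at 0 of the transform of [sinc^k]. *)
Definition sinc_mass k : R := \int[mu]_u (sinc u ^+ k).

(** The product of the constants of the symbol inequality, of the Fourier
    normalization and of the mass of the sinc power; [s0] is an upper bound for the
    scale [s]. *)
Definition pairing_const (s0 : R) : R :=
  kappa * c * 2 ^+ d * sinc_mass (2 * m).+2 ^+ d / (2 ^+ (m * d) * s0 `^ (2 * tau)).

Lemma sinc_mass_even_gt0 : 0 < sinc_mass (2 * m).+2.
Proof. by apply: Rintegral_sinc_gt0; rewrite mul2n odd_double. Qed.

Lemma pairing_const_gt0 s0 : 0 < s0 -> 0 < pairing_const s0.
Proof.
move=> s0_gt0; rewrite divr_gt0// ?mulr_gt0 ?exprn_gt0 ?powR_gt0 ?sinc_mass_even_gt0//.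
by rewrite mulr_gt0// pi_gt0.
Qed.

(** The tent contributes two of the sinc factors of the left-hand side at each
    coordinate, with their zeros; the other [2 m] factors only have to decay as fast
    as [Phihat]. *)
Lemma symbol_ge s s0 w : 0 < s -> s <= s0 -> 1 <= s0 ->
  c * (s / s0) `^ (2 * tau) * (2 * s) ^+ d / 2 ^+ (m * d) * sinc_pow_rV (2 * m).+2 s w <=
  Phihat w * tent_hat_rV (2 * s) w.
Proof.
move=> s_gt0 ss0 s01.
have two : 0 < 2 ^+ (m * d) :> R by rewrite exprn_gt0.
have hat : (2 * s) ^+ d * sinc_pow_rV 2 s w <= tent_hat_rV (2 * s) w.
  rewrite /tent_hat_rV big_split/= prodr_const card_ord.
  rewrite ler_wpM2l ?exprn_ge0 ?mulr_ge0 ?(ltW s_gt0)//.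
  apply: ler_prod => i _; rewrite sqr_ge0/=.
  apply: le_trans (tent_hat_ge _); rewrite (_ : _ / 2 = s * w ord0 i)//.
  by field.
have sinc2_ge0 : 0 <= sinc_pow_rV 2 s w by apply: prodr_ge0 => i _; exact: sqr_ge0.
have split_pow : sinc_pow_rV (2 * m).+2 s w = sinc_pow_rV (2 * m) s w * sinc_pow_rV 2 s w.
  by rewrite /sinc_pow_rV -big_split/=; apply: eq_bigr => i _; rewrite -exprD addn2.
apply: (@le_trans _ _ (c * (1 + enorm w ^+ 2) `^ (- tau) *
    ((2 * s) ^+ d * sinc_pow_rV 2 s w))); last first.
  apply: ler_pM => //; first by rewrite mulr_ge0 ?powR_ge0// ltW.
  by rewrite mulr_ge0// exprn_ge0// mulr_ge0// ltW.
have H : (s / s0) `^ (2 * tau) * sinc_pow_rV (2 * m) s w / 2 ^+ (m * d) <=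
    (1 + enorm w ^+ 2) `^ (- tau).
  by rewrite ler_pdivrMr// [leRHS]mulrC; exact: sinc_pow_rV_le.
rewrite split_pow (_ : c * _ * _ / _ * _ =
  c * ((s / s0) `^ (2 * tau) * sinc_pow_rV (2 * m) s w / 2 ^+ (m * d)) *
  ((2 * s) ^+ d * sinc_pow_rV 2 s w)); last by ring.
by rewrite ler_wpM2r ?mulr_ge0 ?exprn_ge0 ?mulr_ge0 ?(ltW s_gt0)// ler_wpM2l// ltW.
Qed.

(** Since the trigonometric square is nonnegative, the symbol may be replaced by the
    smaller sinc power, whose transform vanishes at the differences of distinct
    points: only the diagonal terms remain. *)
Lemma pairing_lower n (X : 'I_n -> 'rV[R]_d) (v : 'I_n -> R) s s0 :
  0 < s -> s <= s0 -> 1 <= s0 ->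
  (forall i j, i != j -> exists k, (2 * m).+2%:R * s <= `|X i ord0 k - X j ord0 k|) ->
  pairing_const s0 * s `^ (2 * tau) * \sum_i v i ^+ 2 <=
  \sum_i \sum_j v i * v j * \int[leb]_y (tent_rV (2 * s) (X j) y * Phi (X i - y)).
Proof.
move=> s_gt0 ss0 s01 sep.
have s0_gt0 : 0 < s0 by rewrite (lt_le_trans _ s01).
have s2 : 0 < 2 * s by rewrite mulr_gt0.
set K := (2 * m).+2 in sep *.
set E := c * (s / s0) `^ (2 * tau) * (2 * s) ^+ d / 2 ^+ (m * d).
have iP : leb.-integrable setT (EFin \o Phihat) by exact: PhiF.1.
pose S (w : 'rV[R]_d) := \sum_i \sum_j v i * v j * cos (dotr w (X i - X j)).
have S_ge0 w : 0 <= S w.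
  rewrite /S; under eq_bigr do under eq_bigr do rewrite dotr_subr.
  by rewrite (sum_cosB v (fun i => dotr w (X i))) addr_ge0 ?sqr_ge0.
have sum_int (g : 'rV[R]_d -> R) : leb.-integrable setT (EFin \o g) ->
    leb.-integrable setT (EFin \o (fun w => g w * S w)) /\
    \int[leb]_w (g w * S w) =
    \sum_i \sum_j v i * v j * \int[leb]_w (g w * cos (dotr w (X i - X j))).
  move=> ig.
  have igc z : leb.-integrable setT (EFin \o (fun w => g w * cos (dotr w z))).
    apply: integrable_mul_bounded => //; last by move=> w _; exact: cos_max.
    by apply: (measurableT_comp measurable_cos); apply: measurable_dotr.
  have gS w : g w * S w = \sum_i \sum_j v i * v j * (g w * cos (dotr w (X i - X j))).
    rewrite /S mulr_sumr; apply: eq_bigr => i _; rewrite mulr_sumr.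
    by apply: eq_bigr => j _; rewrite mulrCA.
  have H1 i := Rintegral_sum measurableT
    (fun j => EFin_integrableZl (v i * v j) measurableT (igc (X i - X j))).
  have H2 := Rintegral_sum measurableT (fun i => (H1 i).1).
  rewrite (_ : (fun w => _) =
      (fun w => \sum_i \sum_j v i * v j * (g w * cos (dotr w (X i - X j))))).
    split; first exact: H2.1.
    rewrite H2.2; apply: eq_bigr => i _; rewrite (H1 i).2; apply: eq_bigr => j _.
    by rewrite RintegralZl.
  exact/funext.
have isinc : leb.-integrable setT (EFin \o sinc_pow_rV (n := d) K s).
  exact: integrable_sinc_pow_rV.
have ihat : leb.-integrable setT (EFin \o (fun w => Phihat w * tent_hat_rV (2 * s) w)).
  exact: (integrable_fourier_tent PhiF).
have [iL eL] := sum_int _ isinc.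
have [iU eU] := sum_int _ ihat.
apply: (@le_trans _ _ (kappa * (E * \int[leb]_w (sinc_pow_rV K s w * S w)))); last first.
  rewrite (_ : \sum_i _ = kappa * \int[leb]_w (Phihat w * tent_hat_rV (2 * s) w * S w)).
    rewrite ler_wpM2l ?(ltW kappa_gt0)// -RintegralZl//; apply: le_Rintegral => //.
      exact: EFin_integrableZl.
    by move=> w _; rewrite mulrA ler_wpM2r// symbol_ge.
  rewrite eU mulr_sumr; apply: eq_bigr => i _; rewrite mulr_sumr; apply: eq_bigr => j _.
  by rewrite (fourier_tent_pairing PhiF)// mulrCA.
rewrite eL [X in _ <= _ * (_ * X)](_ : _ =
    (s^-1 * sinc_mass (2 * m).+2) ^+ d * \sum_i v i ^+ 2); last first.
  rewrite mulr_sumr; apply: eq_bigr => i _; rewrite (bigD1 i)//= big1 ?addr0; last first.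
    move=> j ji; have [|k Hk] := sep i j; first by rewrite eq_sym.
    by rewrite (Rintegral_sinc_pow_rV_eq0 (i := k)) ?mulr0// !mxE.
  rewrite -(Rintegral_sinc_pow_rV_mass d (2 * m) s_gt0) subrr mulrC -expr2; congr (_ * _).
  by apply: eq_Rintegral => w _; rewrite /dotr big1 ?cos0 ?mulr1// => k _; rewrite mxE mulr0.
rewrite le_eqVlt; apply/orP; left; apply/eqP.
rewrite /pairing_const /E powRM ?invr_ge0 ?(ltW s_gt0) ?(ltW s0_gt0)//.
rewrite -[s0^-1]powR_inv1 ?(ltW s0_gt0)// -powRrM mulN1r powRN !exprMn exprVn.
have ns : s ^+ d != 0 by rewrite expf_neq0// gt_eqF.
have nt : s0 `^ (2 * tau) != 0 by rewrite gt_eqF// powR_gt0.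
have n2 : 2 ^+ (m * d) != 0 :> R by rewrite expf_neq0.
by field; rewrite ns nt n2.
Qed.

End LowerBound.

(** * Quadratic form of the kernel matrix and its condition number *)

Section Condition.
Context {R : realType}.

Lemma sum_sqr_gt0 n (v : 'rV[R]_n) : v != 0 -> 0 < \sum_i v ord0 i ^+ 2.
Proof.
move=> v0; have [i vi] : exists i, v ord0 i != 0.
  apply/existsP; apply: contraNT v0; rewrite negb_exists => /forallP H.
  by apply/eqP/rowP => i; rewrite mxE; have := H i; rewrite negbK => /eqP.
rewrite (bigD1 i)//= ltr_wpDr ?exprn_even_gt0//.
by apply: sumr_ge0 => j _; exact: sqr_ge0.
Qed.

(** Every eigenvalue is a Rayleigh quotient.  If there were no eigenvalue, the
    supremum of the empty set would be 0 and the bound would be trivial. *)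
Lemma cond_le n (K : 'M[R]_n) (gamma Lambda : R) : 0 < gamma -> 0 <= Lambda ->
  (forall v : 'rV[R]_n, gamma * \sum_i v ord0 i ^+ 2 <= (v *m K *m v^T) ord0 ord0) ->
  (forall v : 'rV[R]_n, (v *m K *m v^T) ord0 ord0 <= Lambda * \sum_i v ord0 i ^+ 2) ->
  cond K <= Lambda / gamma.
Proof.
move=> g0 L0 lo up.
have eig a : eigenvalue K a -> gamma <= a <= Lambda.
  move=> /eigenvalueP[v vK v0].
  have N0 := sum_sqr_gt0 v0.
  have E : (v *m K *m v^T) ord0 ord0 = a * \sum_i v ord0 i ^+ 2.
    rewrite vK mxE mulr_sumr; apply: eq_bigr => i _.
    by rewrite !mxE expr2 mulrA.
  by have := lo v; have := up v; rewrite E !ler_pM2r// => -> ->.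
rewrite /cond /lambda_max /lambda_min.
have [->|/set0P[a ea]] := eqVneq [set a | eigenvalue K a] set0.
  by rewrite sup0 mul0r divr_ge0// ltW.
have sE : sup [set a | eigenvalue K a] <= Lambda.
  by apply: ge_sup; [exists a|move=> b /eig/andP[]].
have iE : gamma <= inf [set a | eigenvalue K a].
  by apply: lb_le_inf; [exists a|move=> b /eig/andP[]].
have i0 := lt_le_trans g0 iE.
apply: ler_pM => //; last by rewrite lef_pV2 ?posrE.
  apply: (le_trans (ltW i0)); apply: (le_trans (y := a)).
    by apply: ge_inf => //; exists gamma => b /eig/andP[].
  by apply: ub_le_sup => //; exists Lambda => b /eig/andP[].
by rewrite invr_ge0 ltW.
Qed.

End Condition.

Lemma measurable_reflect_shift {R : realType} {d : nat} (Phi : 'rV[R]_d -> R) (x : 'rV[R]_d) :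
  measurable_fun setT Phi -> measurable_fun setT (fun y : 'rV[R]_d => Phi (x - y)).
Proof.
move=> mPhi; apply: (measurableT_comp mPhi); apply: measurable_fun_coord => i.
under eq_fun do rewrite !mxE.
by apply: measurable_funB; [exact: measurable_cst|exact: measurable_coord].
Qed.

Section KernelForm.
Context {R : realType} {d n : nat}.
Local Notation leb := (@lebesgue_rV R d).
Variables (Omega : set 'rV[R]_d) (Phi : 'rV[R]_d -> R) (k : 'rV[R]_d -> 'rV[R]_d -> R).
Variables (X : 'I_n -> 'rV[R]_d) (B : R).
Hypotheses (mO : measurable Omega) (Ofin : (leb Omega < +oo)%E).
Hypothesis kPhi : translational_invariant_kernel k Phi.
Hypotheses (mPhi : measurable_fun setT Phi) (PhiB : forall x, `|Phi x| <= B).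

Let K := kernel_matrix (conv_kernel Omega k) X.

(** The linear combination of kernel translates whose squared norm in
    [L^2(Omega)] is the quadratic form of the kernel matrix. *)
Definition trial (v : 'rV[R]_n) (y : 'rV[R]_d) : R := \sum_i v ord0 i * Phi (X i - y).

Lemma integrable_bounded_on (f : 'rV[R]_d -> R) (C : R) : measurable_fun setT f ->
  (forall y, `|f y| <= C) -> leb.-integrable Omega (EFin \o f).
Proof.
move=> mf fC; apply: measurable_bounded_integrable => //.
  exact: measurable_funTS.
exists C; split; first exact: num_real.
by move=> C' CC' y _; exact: (le_trans (fC y) (ltW CC')).
Qed.

Lemma measurable_trial v : measurable_fun setT (trial v).
Proof.
apply: measurable_sum => i; apply: measurable_funM; first exact: measurable_cst.
exact: measurable_reflect_shift.
Qed.

Lemma trial_sqr_bound v y : trial v y ^+ 2 <= n%:R * B ^+ 2 * \sum_i v ord0 i ^+ 2.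
Proof.
apply: le_trans (sqr_sum_le _) _; rewrite -mulrA ler_wpM2l// mulr_sumr.
apply: ler_sum => i _; rewrite exprMn mulrC ler_wpM2r ?sqr_ge0//.
rewrite -(real_normK (num_real (Phi _))) lerXn2r ?nnegrE//.
exact: le_trans (PhiB 0).
Qed.

Lemma integrable_trial_sqr v : leb.-integrable Omega (EFin \o (fun y : 'rV[R]_d => trial v y ^+ 2)).
Proof.
apply: (integrable_bounded_on (C := n%:R * B ^+ 2 * \sum_i v ord0 i ^+ 2)).
  by apply: measurable_funX; exact: measurable_trial.
by move=> y; rewrite ger0_norm ?sqr_ge0// trial_sqr_bound.
Qed.

Lemma kernel_formE (v : 'rV[R]_n) :
  (v *m K *m v^T) ord0 ord0 = \int[leb]_(y in Omega) (trial v y ^+ 2).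
Proof.
have ik i j : leb.-integrable Omega (EFin \o (fun y : 'rV[R]_d => Phi (X i - y) * Phi (X j - y))).
  apply: (integrable_bounded_on (C := B * B)).
    by apply: measurable_funM; exact: measurable_reflect_shift.
  by move=> y; rewrite normrM ler_pM.
have H1 i := Rintegral_sum mO
  (fun j => EFin_integrableZl (v ord0 i * v ord0 j) mO (ik i j)).
have H2 := Rintegral_sum mO (fun i => (H1 i).1).
transitivity (\int[leb]_(y in Omega) (\sum_i \sum_j
    v ord0 i * v ord0 j * (Phi (X i - y) * Phi (X j - y)))).
  rewrite H2.2 mxE; under eq_bigr do rewrite mxE mulr_suml.
  rewrite exchange_big/=; apply: eq_bigr => i _; rewrite (H1 i).2.
  apply: eq_bigr => j _; rewrite (RintegralZl _ mO (ik i j)) !mxE mulrAC; congr (_ * _).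
  rewrite /conv_kernel; apply: eq_Rintegral => y _.
  by rewrite (kPhi.1 y) !kPhi.2.
apply: eq_Rintegral => y _; rewrite /trial expr2 mulr_suml; apply: eq_bigr => i _.
by rewrite mulr_sumr; apply: eq_bigr => j _; ring.
Qed.

Lemma kernel_matrix_sym : K^T = K.
Proof.
apply/matrixP => i j; rewrite !mxE /conv_kernel; apply: eq_Rintegral => y _.
by rewrite mulrC (kPhi.1 _ (X i)) (kPhi.1 (X j)).
Qed.

Lemma kernel_form_le (v : 'rV[R]_n) :
  (v *m K *m v^T) ord0 ord0 <= n%:R * B ^+ 2 * fine (leb Omega) * \sum_i v ord0 i ^+ 2.
Proof.
rewrite kernel_formE mulrAC -(Rintegral_cst leb mO).
apply: le_Rintegral => //; first exact: integrable_trial_sqr.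
  apply: (integrable_bounded_on (C := `|n%:R * B ^+ 2 * \sum_i v ord0 i ^+ 2|)) => //.
by move=> y _; exact: trial_sqr_bound.
Qed.

(** Duality against the test function [g]: integrate [f^2 >= 2 l f g - l^2 g^2] with
    the optimal [l = A / b]. *)
Lemma kernel_form_ge (v : 'rV[R]_n) (g : 'rV[R]_d -> R) (C A b N : R) : measurable_fun setT g ->
  (forall y, `|g y| <= C) -> 0 < b ->
  A * N <= \int[leb]_(y in Omega) (trial v y * g y) ->
  \int[leb]_(y in Omega) (g y ^+ 2) <= b * N -> 0 <= A ->
  A ^+ 2 / b * N <= (v *m K *m v^T) ord0 ord0.
Proof.
move=> mg gC b0 fg gg A0; rewrite kernel_formE.
have ig2 : leb.-integrable Omega (EFin \o (fun y : 'rV[R]_d => g y ^+ 2)).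
  apply: (integrable_bounded_on (C := C ^+ 2)); first exact: measurable_funX.
  by move=> y; rewrite normrX lerXn2r ?nnegrE//; exact: le_trans (gC y).
have iF := integrable_trial_sqr v.
set D := n%:R * B ^+ 2 * \sum_i v ord0 i ^+ 2.
have ifg : leb.-integrable Omega (EFin \o (fun y : 'rV[R]_d => trial v y * g y)).
  apply: (integrable_bounded_on (C := (D + C ^+ 2))).
    by apply: measurable_funM => //; exact: measurable_trial.
  move=> y; have := trial_sqr_bound v y; rewrite -/D.
  have : g y ^+ 2 <= C ^+ 2.
    by rewrite -(real_normK (num_real (g y))) lerXn2r ?nnegrE//; exact: le_trans (gC y).
  have := sqr_ge0 (trial v y - g y); have := sqr_ge0 (trial v y + g y).
  rewrite sqrrB sqrrD => ? ? ? ?; rewrite ler_norml; apply/andP; split; nra.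
set l := A / b.
have l0 : 0 <= l by rewrite divr_ge0// ltW.
have i1 := EFin_integrableZl (2 * l) mO ifg.
have i2 := EFin_integrableZl (l ^+ 2) mO ig2.
apply: (@le_trans _ _ (\int[leb]_(y in Omega) (2 * l * (trial v y * g y) - l ^+ 2 * g y ^+ 2))).
  rewrite (RintegralB mO i1 i2) (RintegralZl _ mO ifg) (RintegralZl _ mO ig2).
  apply: (@le_trans _ _ (2 * l * (A * N) - l ^+ 2 * (b * N))).
    by rewrite le_eqVlt; apply/orP; left; apply/eqP; rewrite /l; field; rewrite gt_eqF.
  apply: lerB; first by rewrite ler_wpM2l// mulr_ge0.
  by rewrite ler_wpM2l// sqr_ge0.
apply: le_Rintegral => //; first exact: EFin_integrableB.
by move=> y _; have := sqr_ge0 (trial v y - l * g y); rewrite sqrrB exprMn; lra.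
Qed.

End KernelForm.

(** The test function of the duality argument: a combination of tents with disjoint
    supports inside [Omega]. *)
Section TestFunction.
Context {R : realType} {d n : nat}.
Local Notation leb := (@lebesgue_rV R d).
Variables (Omega : set 'rV[R]_d) (X : 'I_n -> 'rV[R]_d) (s : R) (v : 'rV[R]_n).
Hypothesis s_gt0 : 0 < s.
Hypothesis box_sub : forall i (y : 'rV[R]_d), (forall k, `|y ord0 k - X i ord0 k| < s) -> Omega y.
Hypothesis sep : forall i j, i != j -> exists k, 2 * s <= `|X i ord0 k - X j ord0 k|.

Definition bump_sum (y : 'rV[R]_d) : R := \sum_j v ord0 j * tent_rV s (X j) y.

Let tent_supp i y : tent_rV s (X i) y != 0 -> forall k, `|y ord0 k - X i ord0 k| < s.
Proof.
move=> ty k; rewrite ltNge; apply: contra ty => yk.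
by rewrite (tent_rV_eq0 s_gt0 yk).
Qed.

Lemma measurable_bump_sum : measurable_fun setT bump_sum.
Proof.
apply: measurable_sum => j; apply: measurable_funM; first exact: measurable_cst.
exact: (integrable_measurable measurableT (integrable_tent_rV (X j) s_gt0)).
Qed.

Lemma bump_sum_bound y : `|bump_sum y| <= \sum_j `|v ord0 j|.
Proof.
apply: le_trans (ler_norm_sum _ _ _) _; apply: ler_sum => j _.
by rewrite normrM ler_piMr// ger0_norm ?tent_rV_ge0// tent_rV_le1.
Qed.

Lemma bump_sum_supp y : ~ Omega y -> bump_sum y = 0.
Proof.
move=> nOy; apply: big1 => j _; have [->|] := eqVneq (tent_rV s (X j) y) 0.
  by rewrite mulr0.
by move/tent_supp/box_sub.
Qed.

Lemma bump_sum_sqr y : bump_sum y ^+ 2 = \sum_j v ord0 j ^+ 2 * tent_rV s (X j) y ^+ 2.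
Proof.
rewrite expr2 mulr_suml; apply: eq_bigr => i _.
rewrite /bump_sum mulr_sumr (bigD1 i)//= big1 ?addr0; first by ring.
move=> j ji; have [->|ti] := eqVneq (tent_rV s (X i) y) 0; first by rewrite mulr0 mul0r.
have [->|tj] := eqVneq (tent_rV s (X j) y) 0; first by rewrite !mulr0.
have [k] : exists k, 2 * s <= `|X j ord0 k - X i ord0 k| by exact: sep.
have := tent_supp ti k; have := tent_supp tj k.
rewrite !ltr_norml => /andP[a1 a2] /andP[b1 b2].
by rewrite ler_normr => /orP[]; lra.
Qed.

(** The supports are disjoint and [tent^2 <= tent]; the integral of one
    multivariate tent is its symbol at frequency 0.  The 1 added to it makes
    the constant positive. *)
Lemma Rintegral_bump_sum_sqr :
  \int[leb]_(y in Omega) (bump_sum y ^+ 2) <=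
  (s * (1 + tent_hat 0)) ^+ d * \sum_i v ord0 i ^+ 2.
Proof.
have iT j : leb.-integrable setT (EFin \o tent_rV s (X j)) by exact: integrable_tent_rV.
have T2 j y : tent_rV s (X j) y ^+ 2 <= tent_rV s (X j) y.
  by rewrite expr2 ler_piMr ?tent_rV_ge0// tent_rV_le1.
have H := Rintegral_sum measurableT
  (fun j => EFin_integrableZl (v ord0 j ^+ 2) measurableT (iT j)).
rewrite Rintegral_mkcond.
apply: (@le_trans _ _ (\int[leb]_y (\sum_j v ord0 j ^+ 2 * tent_rV s (X j) y))).
  have pw y : bump_sum y ^+ 2 <= \sum_j v ord0 j ^+ 2 * tent_rV s (X j) y.
    by rewrite bump_sum_sqr; apply: ler_sum => j _; rewrite ler_wpM2l ?sqr_ge0.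
  rewrite (_ : (fun y => bump_sum y ^+ 2) \_ Omega = (fun y => bump_sum y ^+ 2)); last first.
    apply/funext => y; rewrite patchE; case: ifPn => // /negP nOy.
    by rewrite bump_sum_supp ?expr0n// => Oy; apply: nOy; rewrite inE.
  apply: le_Rintegral => //; last exact: H.1.
  apply: (dominated_integrable measurableT _ H.1).
    by apply: measurable_funX; exact: measurable_bump_sum.
  by move=> y _; rewrite ger0_norm ?sqr_ge0.
rewrite H.2 mulr_sumr; apply: ler_sum => j _.
rewrite (RintegralZl _ measurableT (iT j)) mulrC ler_wpM2r ?sqr_ge0//.
have -> : \int[leb]_y tent_rV s (X j) y = tent_hat_rV s (0 : 'rV[R]_d).
  have := Rintegral_tent_rV (X j) (X j) 0 s_gt0.
  rewrite subrr {2}/dotr big1 ?cos0 ?mulr1 => [<-|i _]; last by rewrite mxE mul0r.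
  apply: eq_Rintegral => y _; rewrite /dotr big1 ?cos0 ?mulr1// => i _.
  by rewrite mxE mul0r.
rewrite /tent_hat_rV -[X in _ <= _ ^+ X](card_ord d) -prodr_const.
apply: ler_prod => i _; rewrite mxE mulr0 mulr_ge0 ?tent_hat_ge0 ?(ltW s_gt0)//=.
by rewrite ler_wpM2l ?(ltW s_gt0)// lerDr.
Qed.

Lemma Rintegral_trial_bump (Phi : 'rV[R]_d -> R) (B : R) :
  measurable_fun setT Phi -> (forall x, `|Phi x| <= B) ->
  \int[leb]_(y in Omega) (trial Phi X v y * bump_sum y) =
  \sum_i \sum_j v ord0 i * v ord0 j * \int[leb]_y (tent_rV s (X j) y * Phi (X i - y)).
Proof.
move=> mPhi PhiB.
have iT j : leb.-integrable setT (EFin \o tent_rV s (X j)) by exact: integrable_tent_rV.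
have iTP i j : leb.-integrable setT
    (EFin \o (fun y : 'rV[R]_d => tent_rV s (X j) y * Phi (X i - y))).
  apply: (@dominated_integrable _ _ R leb setT
    (fun y : 'rV[R]_d => tent_rV s (X j) y * Phi (X i - y))
    (fun y : 'rV[R]_d => B * tent_rV s (X j) y)) => //.
  - apply: measurable_funM; first exact: (integrable_measurable measurableT (iT j)).
    exact: measurable_reflect_shift.
  - exact: EFin_integrableZl.
  - move=> y _; rewrite normrM mulrC (ger0_norm (tent_rV_ge0 _ _ _)).
    by rewrite ler_wpM2r// tent_rV_ge0.
have H1 i := Rintegral_sum measurableT
  (fun j => EFin_integrableZl (v ord0 i * v ord0 j) measurableT (iTP i j)).
have H2 := Rintegral_sum measurableT (fun i => (H1 i).1).
transitivity (\int[leb]_y (\sum_i \sum_j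
    v ord0 i * v ord0 j * (tent_rV s (X j) y * Phi (X i - y)))).
  rewrite Rintegral_mkcond; apply: eq_Rintegral => y _.
  transitivity (trial Phi X v y * bump_sum y).
    rewrite patchE; case: ifPn => // /negP nOy.
    by rewrite bump_sum_supp ?mulr0// => Oy; apply: nOy; rewrite inE.
  rewrite /trial mulr_suml; apply: eq_bigr => i _; rewrite mulr_sumr.
  by apply: eq_bigr => j _; ring.
rewrite H2.2; apply: eq_bigr => i _; rewrite (H1 i).2; apply: eq_bigr => j _.
by rewrite (RintegralZl _ measurableT (iTP i j)).
Qed.

End TestFunction.

(** * The condition number bound *)

Theorem corollary7 (R : realType) (d : nat) (d_gt0 : (0 < d)%N)
    (Omega : set 'rV[R]_d) (Omega_domain : is_domain Omega)
    (Omega_bounded : bounded_set Omega)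
    (k : 'rV[R]_d -> 'rV[R]_d -> R) (Phi Phihat : 'rV[R]_d -> R)
    (k_Phi : translational_invariant_kernel k Phi)
    (Phi_Phihat : is_fourier_transform Phi Phihat)
    (tau c_Phi C_Phi : R) (tau_gt : d%:R / 2 < tau)
    (c_Phi_gt0 : 0 < c_Phi) (C_Phi_gt0 : 0 < C_Phi)
    (Phihat_bounds : forall w : 'rV[R]_d,
      c_Phi * (1 + enorm w ^+ 2) `^ (- tau) <= Phihat w /\
      Phihat w <= C_Phi * (1 + enorm w ^+ 2) `^ (- tau)) :
  exists c : R, 0 < c /\
    forall (n : nat) (X : 'I_n -> 'rV[R]_d),
      (2 <= n)%N -> injective X -> (forall i, Omega (X i)) ->
      let q := Num.min (dist_boundary X Omega) (separation_distance X) in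
      let K := kernel_matrix (conv_kernel Omega k) X in
      [/\ 0 < q, sym_posdef K & cond K <= c * q `^ (- (4 * tau))].
Proof.
have [oO cO nO] := Omega_domain.
have mO : measurable Omega := open_measurable_rV oO.
have Ofin := bounded_finite_measure oO Omega_bounded.
have [M M0 HM] := bounded_coord Omega_bounded.
have tau0 : 0 < tau by apply: le_lt_trans tau_gt; rewrite divr_ge0.
(* At least tau: this many pairs of sinc factors decay as fast as Phihat. *)
set m := Num.bound tau.
have tau_m : tau <= m%:R by rewrite ltW// archi_boundP// ltW.
have m_gt0 : (0 < m)%N by rewrite -(ltr_nat R) (lt_le_trans tau0).
have Phihat_ge w := (Phihat_bounds w).1.
have Phihat_ge0 w : 0 <= Phihat w.
  by apply: le_trans (Phihat_ge w); rewrite mulr_ge0 ?powR_ge0// ltW.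
set B := (2 * pi) `^ (- (d%:R / 2)) * \int[lebesgue_rV d]_w Phihat w.
have PhiB : forall x, `|Phi x| <= B by exact: fourier_bound.
have mPhi : measurable_fun setT Phi by exact: measurable_fourier Phi_Phihat Phihat_ge0.
set V := fine (lebesgue_rV d Omega).
have V0 : 0 <= V by exact: fine_ge0.
pose D : R := d%:R.
have D0 : 0 < D by rewrite ltr0n.
have D1 : 1 <= D by rewrite ler1n.
(* A bound for every scale s that is independent of the points. *)
pose s0 := 1 + D * M.
have s01 : 1 <= s0 by rewrite lerDl mulr_ge0// ltW.
have s00 : 0 < s0 by rewrite (lt_le_trans _ s01).
pose P := @pairing_const R d tau c_Phi m s0.
have P0 : 0 < P by exact: pairing_const_gt0.
pose L : R := (2 * m).+2%:R.
have L4 : 4 <= L by rewrite /L (ler_nat R 4) mul2n -addnn; case: (m) m_gt0 => // p _; rewrite addnS.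
have L0 : 0 < L by rewrite (lt_le_trans _ L4).
pose t : R := (1 + tent_hat 0) / 2.
have t0 : 0 < t by rewrite divr_gt0// ltr_pwDl// tent_hat_ge0.
pose C := B ^+ 2 * V ^+ 2 * t ^+ d / P ^+ 2 * (D * L) `^ (4 * tau).
have C0 : 0 <= C.
  rewrite mulr_ge0 ?powR_ge0// divr_ge0 ?sqr_ge0//.
  apply: mulr_ge0; last by rewrite exprn_ge0// ltW.
  by apply: mulr_ge0; exact: sqr_ge0.
exists (1 + C); split; first by rewrite ltr_pwDl.
move=> n X n2 injX OX /=.
set q := Num.min _ _; set K := kernel_matrix _ _.
have n0 : (0 < n)%N by exact: ltnW.
have q0 : 0 < q.
  rewrite lt_min separation_distance_gt0// andbT.
  exact: dist_boundary_gt0.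
have qd : q <= dist_boundary X Omega by rewrite ge_min lexx.
have qs : q <= separation_distance X by rewrite ge_min lexx orbT.
(* D turns Euclidean distances into coordinate distances, and L = 2m+2 is the
   half-length of the support of the transform of the sinc power. *)
pose s := q / (D * L).
have DL0 : 0 < D * L by rewrite mulr_gt0.
have s_gt0 : 0 < s by rewrite divr_gt0.
have ss0 : s <= s0.
  have : separation_distance X <= D * M.
    by apply: separation_distance_bounded => // [i k'|]; [exact: HM|exact: ltW].
  have DL1 : 1 <= D * L by rewrite mulr_ege1//; lra.
  have : s <= q by rewrite ler_pdivrMr// ler_peMr// ltW.
  by rewrite /s0; lra.
have s2_gt0 : 0 < 2 * s by rewrite mulr_gt0.
have Ds2 : D * (2 * s) < q.
  have -> : D * (2 * s) = q * (2 / L) by rewrite /s; field; rewrite !gt_eqF.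
  by rewrite gtr_pMr// ltr_pdivrMr// mul1r; lra.
(* If all coordinates of X i - X j were below L s, its norm would be at most q,
   while it is at least 2 q. *)
have sepL i j : i != j -> exists k', L * s <= `|X i ord0 k' - X j ord0 k'|.
  move=> ij; apply: contrapT => nk.
  have : enorm (X i - X j) <= D * (L * s).
    apply: enorm_le; first by rewrite mulr_ge0// ltW.
    move=> k'; rewrite !mxE leNgt; apply/negP => lt_k.
    by apply: nk; exists k'; exact: ltW.
  have := @separation_distance_le _ _ _ X i j (contra_neq (@injX i j) ij).
  have -> : D * (L * s) = q by rewrite /s; field; rewrite !gt_eqF.
  by lra.
have sep2 i j : i != j -> exists k', 2 * (2 * s) <= `|X i ord0 k' - X j ord0 k'|.
  move=> /sepL[k' Hk]; exists k'; apply: le_trans Hk.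
  by rewrite mulrA ler_wpM2r ?(ltW s_gt0)//; lra.
have box_sub i (y : 'rV[R]_d) : (forall k', `|y ord0 k' - X i ord0 k'| < 2 * s) -> Omega y.
  move=> Hy; apply: (box_sub_domain (i := i) oO OX (ltW s2_gt0) (lt_le_trans Ds2 qd)).
  by move=> k'; exact: ltW.
(* A bounds the pairing of f and g from below, b the squared norm of g from above. *)
pose A := P * s `^ (2 * tau).
have A0 : 0 < A by rewrite mulr_gt0// powR_gt0.
pose b := (2 * s * (1 + tent_hat 0)) ^+ d.
have b0 : 0 < b by rewrite exprn_gt0// mulr_gt0// ltr_pwDl// tent_hat_ge0.
have lower (v : 'rV[R]_n) : A ^+ 2 / b * \sum_i v ord0 i ^+ 2 <= (v *m K *m v^T) ord0 ord0.
  apply: (@kernel_form_ge _ _ _ Omega Phi k X B mO Ofin k_Phi mPhi PhiB v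
    (bump_sum X (2 * s) v) (\sum_j `|v ord0 j|)).
  - exact: measurable_bump_sum.
  - exact: bump_sum_bound.
  - exact: b0.
  - rewrite (Rintegral_trial_bump v s2_gt0 box_sub mPhi PhiB).
    exact: (pairing_lower Phi_Phihat tau0 c_Phi_gt0 Phihat_ge tau_m).
  - exact: Rintegral_bump_sum_sqr.
  - exact: ltW.
have upper := kernel_form_le X mO Ofin k_Phi mPhi PhiB.
have gamma0 : 0 < A ^+ 2 / b by rewrite divr_gt0// exprn_gt0.
split => //.
- split; first exact: (kernel_matrix_sym _ _ k_Phi).
  by move=> v v0; apply: lt_le_trans (lower v); rewrite mulr_gt0// sum_sqr_gt0.
have := cond_le gamma0 _ lower upper; rewrite -/V => cl.
apply: le_trans (cl _) _; first by rewrite mulr_ge0// mulr_ge0// sqr_ge0.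
(* This cancels n against the factor s^d of b. *)
have pack : n%:R * (2 * (2 * s)) ^+ d <= V.
  rewrite -lee_fin /V fineK ?ge0_fin_numE//.
  by apply: packing_bound => //; exact: lt_le_trans Ds2 _.
have sE : s `^ (2 * tau) ^+ 2 = s `^ (4 * tau).
  by rewrite -powR_mulrn ?powR_ge0// -powRrM; congr (_ `^ _); ring.
have qE : s `^ (4 * tau) = q `^ (4 * tau) / (D * L) `^ (4 * tau).
  rewrite /s [LHS]powRM ?invr_ge0 ?(ltW q0) ?(ltW DL0)//.
  by rewrite -[(D * L)^-1]powR_inv1 ?(ltW DL0)// -powRrM mulN1r powRN.
have AE : A ^+ 2 = P ^+ 2 * (q `^ (4 * tau) / (D * L) `^ (4 * tau)).
  by rewrite /A [LHS]exprMn sE qE.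
have qt : 0 < q `^ (4 * tau) by rewrite powR_gt0.
have DLt : 0 < (D * L) `^ (4 * tau) by rewrite powR_gt0.
have bE : b = (2 * (2 * s)) ^+ d * t ^+ d.
  by rewrite /b -exprMn; congr (_ ^+ _); rewrite /t; field.
apply: (@le_trans _ _ (C * q `^ (- (4 * tau)))); last first.
  by rewrite ler_wpM2r ?powR_ge0// lerDr.
rewrite powRN AE bE /C.
have U0 : 0 < (2 * (2 * s)) ^+ d by rewrite exprn_gt0// mulr_gt0.
have T0 : 0 < t ^+ d by rewrite exprn_gt0.
move: (q `^ (4 * tau)) qt ((D * L) `^ (4 * tau)) DLt => Q Q0 E E0.
move: ((2 * (2 * s)) ^+ d) U0 pack (t ^+ d) T0 => U U0 pack T T0.
have PQ : 0 <= B ^+ 2 * V * T * E / (P ^+ 2 * Q).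
  apply: divr_ge0; last by rewrite mulr_ge0 ?sqr_ge0// ltW.
  do 2 (apply: mulr_ge0; last exact: ltW).
  by rewrite mulr_ge0// sqr_ge0.
rewrite [leLHS](_ : _ = n%:R * U * (B ^+ 2 * V * T * E / (P ^+ 2 * Q))); last first.
  by field; rewrite !gt_eqF.
rewrite [leRHS](_ : _ = V * (B ^+ 2 * V * T * E / (P ^+ 2 * Q))); last first.
  by field; rewrite !gt_eqF.
exact: ler_wpM2r.
Qed.
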